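(* For every $s\in(0,1)$ and every integer $n\ge 1$ with $n>2s$, one has $$S_{\mathcal N}(\mathbb{R}^n_+)<S(\mathbb{R}^n).$$
   Context: Notation: $\mathbb{R}^n_+=\{x\in\mathbb{R}^n: x_n>0\}$, $\mathbb{R}^n_-=\{x\in\mathbb{R}^n: x_n<0\}$, $T(\mathbb{R}^n_+)=\mathbb{R}^{2n}\setminus(\mathbb{R}^n_-)^2$, $2^*_s=\frac{2n}{n-2s}$. For measurable $u:\mathbb{R}^n\to\mathbb{R}$ and $\Gamma\subseteq\mathbb{R}^{2n}$ set $\mathcal E(u,\Gamma)=\iint_\Gamma\frac{(u(x)-u(y))^2}{|x-y|^{n+2s}}dxdy$. The space $H^s_{\mathbb{R}^n_+}$ consists of the measurable $u:\mathbb{R}^n\to\mathbb{R}$ with $u\in L^{2^*_s}(\mathbb{R}^n_+)$ and $\mathcal E(u,T(\mathbb{R}^n_+))<\infty$. The Sobolev constant of $\mathbb{R}^n$ is $$S(\mathbb{R}^n)=\inf_{0\ne u\in\mathcal D^s(\mathbb{R}^n)}\frac{\mathcal E(u,\mathbb{R}^{2n})}{\left(\int_{\mathbb{R}^n}|u|^{2^*_s}dx\right)^{2/2^*_s}},$$ where $\mathcal D^s(\mathbb{R}^n)$ is the completion of $C_c^\infty(\mathbb{R}^n)$ with respect to $\mathcal E(\cdot,\mathbb{R}^{2n})$ (i.e. with respect to the norm $\mathcal E(\cdot,\mathbb{R}^{2n})^{1/2}$). The Neumann Sobolev constant of $\mathbb{R}^n_+$ is $$S_{\mathcal N}(\mathbb{R}^n_+)=\inf\frac{\mathcal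 E(u,T(\mathbb{R}^n_+))}{\left(\int_{\mathbb{R}^n_+}|u|^{2^*_s}dx\right)^{2/2^*_s}},$$ the infimum being over $u\in H^s_{\mathbb{R}^n_+}$ that do not vanish a.e. in $\mathbb{R}^n_+$. *)

(* Defs.v *)
From HB Require Import structures.
From mathcomp Require Import all_boot all_order all_algebra.
From mathcomp Require Import all_classical all_reals all_analysis.

Set Implicit Arguments.
Unset Strict Implicit.
Unset Printing Implicit Defensive.

Import Order.TTheory GRing.Theory Num.Theory.
Import numFieldNormedType.Exports.

Local Open Scope classical_set_scope.
Local Open Scope ring_scope.

Definition rV_display : measure_display. Proof. exact: default_measure_display. Qed.

(* The sigma-algebra of 'rV[R]_n is the one generated by the coordinates, i.e.
   the Borel sigma-algebra; this mirrors the library instance on n.-tuple. *)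
Section measurable_rV.
Context {R : realType} (n : nat).

Definition rV_coord (i : 'I_n) (x : 'rV[R]_n) : measurableTypeR R := x ord0 i.

Let rV_set0 : g_sigma_preimage rV_coord set0.
Proof. exact: sigma_algebra0. Qed.

Let rV_setC A : g_sigma_preimage rV_coord A -> g_sigma_preimage rV_coord (~` A).
Proof. exact: sigma_algebraC. Qed.

Let rV_bigcup (F : _^nat) : (forall i, g_sigma_preimage rV_coord (F i)) ->
  g_sigma_preimage rV_coord (\bigcup_i (F i)).
Proof. exact: sigma_algebra_bigcup. Qed.

HB.instance Definition _ := @isMeasurable.Build rV_display
  'rV[R]_n (g_sigma_preimage rV_coord) rV_set0 rV_setC rV_bigcup.

End measurable_rV.

Lemma measurable_rV_coord (R : realType) n (i : 'I_n) :
  measurable_fun [set: 'rV[R]_n] (rV_coord i).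
Proof.
move=> _ Y mY; rewrite setTI; apply: sub_sigma_algebra => /=.
rewrite -bigcup_seq/=; exists i => /=; first by rewrite mem_index_enum.
by exists Y => //; rewrite setTI.
Qed.

Lemma measurable_fun_rVP d (T : measurableType d) (R : realType) n
    (f : T -> 'rV[R]_n) :
  measurable_fun [set: T] f <->
  forall i, measurable_fun [set: T] (rV_coord i \o f).
Proof.
split=> [mf i|mf]; first exact: measurableT_comp (measurable_rV_coord i) mf.
move=> _ Y mY; rewrite setTI.
suff: g_sigma_preimage (fun i => rV_coord i \o f) `<=` measurable.
  by apply; rewrite g_sigma_preimage_comp; exists Y => //; rewrite setTI.
apply: smallest_sub; first exact: sigma_algebra_measurable.
move=> A; rewrite -bigcup_seq/= => -[i _ [B mB <-]].
exact: mf.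
Qed.

(* Lebesgue measure on 'rV[R]_n, as the n-fold product of lebesgue_measure. *)
Section rV_lebesgue.
Context {R : realType}.

Definition rV_cons n (p : measurableTypeR R * 'rV[R]_n) : 'rV[R]_n.+1 :=
  @row_mx R 1 1 n (const_mx p.1) p.2.

Lemma measurable_rV_cons n : measurable_fun setT (@rV_cons n).
Proof.
apply/measurable_fun_rVP => i.
have [j ->|j ->] := split_ordP (i : 'I_(1 + n)).
  rewrite (_ : _ \o _ = fst)//; apply/funext => p /=.
  by apply: etrans (row_mxEl _ _ _ _) _; rewrite mxE.
rewrite (_ : _ \o _ = rV_coord j \o snd).
  by apply: measurableT_comp => //; exact: measurable_rV_coord.
by apply/funext => p; exact: (row_mxEr (const_mx p.1 : 'M[R]_1)).
Qed.

Definition rV_uncons n (x : 'rV[R]_n.+1) : measurableTypeR R * 'rV[R]_n :=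
  (x ord0 ord0, @rsubmx R 1 1 n x).

Lemma rV_consK n : cancel (@rV_cons n) (@rV_uncons n).
Proof.
move=> [a x]; rewrite /rV_uncons; congr (_, _); last exact: row_mxKr.
rewrite (_ : ord0 = @lshift 1 n ord0); last exact/val_inj.
by apply: etrans (row_mxEl _ _ _ _) _; rewrite mxE.
Qed.

Lemma measurable_rV_uncons n : measurable_fun setT (@rV_uncons n).
Proof.
apply/measurable_fun_pairP; split.
  exact: (measurable_rV_coord (ord0 : 'I_n.+1)).
apply/measurable_fun_rVP => j.
rewrite (_ : _ \o _ = rV_coord (rshift 1 j : 'I_n.+1)).
  exact: measurable_rV_coord.
by apply/funext => x /=; rewrite /rV_coord mxE.
Qed.

Section rV_lebesgue_succ.
Variables (n : nat) (m : {sigma_finite_measure set 'rV[R]_n -> \bar R}).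
Local Open Scope ereal_scope.

Definition rV_lebesgue_succ : set 'rV[R]_n.+1 -> \bar R :=
  pushforward (@lebesgue_measure R \x m) (@rV_cons n).

Let preim A : measurable A -> measurable (@rV_cons n @^-1` A).
Proof. by move=> mA; rewrite -[X in measurable X]setTI; exact: measurable_rV_cons. Qed.

Let succ0 : rV_lebesgue_succ set0 = 0.
Proof. by rewrite /rV_lebesgue_succ /pushforward preimage_set0 measure0. Qed.

Let succ_ge0 A : 0 <= rV_lebesgue_succ A.
Proof. by rewrite /rV_lebesgue_succ /pushforward measure_ge0. Qed.

Let succ_sigma_additive : semi_sigma_additive rV_lebesgue_succ.
Proof.
move=> F mF tF mUF; rewrite /rV_lebesgue_succ /pushforward preimage_bigcup.
apply: measure_semi_sigma_additive.
- by move=> k; exact: preim.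
- apply/trivIsetP => /= i j _ _ ij; rewrite -preimage_setI.
  by move/trivIsetP : tF => /(_ _ _ _ _ ij) ->//; rewrite preimage_set0.
- by rewrite -preimage_bigcup; exact: preim.
Qed.

HB.instance Definition _ := isMeasure.Build _ _ _
  rV_lebesgue_succ succ0 succ_ge0 succ_sigma_additive.

Let succ_sigma_finite : sigma_finite setT rV_lebesgue_succ.
Proof.
have /sigma_finiteP[F [TF ndF Foo]] := sigma_finiteT (@lebesgue_measure R).
have /sigma_finiteP[G [TG ndG Goo]] := sigma_finiteT m.
exists (fun k => @rV_uncons n @^-1` (F k `*` G k)).
  rewrite -preimage_bigcup [X in _ @^-1` X](_ : _ = setT) ?preimage_setT//.
  apply/seteqP; split => // -[x y] _.
  have [i _ Fix] : (\bigcup_i F i) x by rewrite -TF.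
  have [j _ Gjy] : (\bigcup_j G j) y by rewrite -TG.
  exists (maxn i j) => //; split => /=.
    by move: x Fix; exact/subsetPset/ndF/leq_maxl.
  by move: y Gjy; exact/subsetPset/ndG/leq_maxr.
move=> k; have [mFk Fkoo] := Foo k; have [mGk Gkoo] := Goo k; split.
  by rewrite -[X in measurable X]setTI; apply: measurable_rV_uncons => //;
    exact: measurableX.
rewrite /rV_lebesgue_succ /pushforward -comp_preimage.
rewrite (_ : _ \o _ = idfun); last by apply/funext => p /=; rewrite rV_consK.
by rewrite preimage_id product_measure1E// lte_mul_pinfty// ge0_fin_numE.
Qed.

HB.instance Definition _ := Measure_isSigmaFinite.Build _ _ _
  rV_lebesgue_succ succ_sigma_finite.

End rV_lebesgue_succ.

Fixpoint rV_lebesgue n : {sigma_finite_measure set 'rV[R]_n -> \bar R} :=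
  if n is k.+1 then [the {sigma_finite_measure set 'rV[R]_k.+1 -> \bar R} of
                       rV_lebesgue_succ (rV_lebesgue k)]
  else [the {sigma_finite_measure set 'rV[R]_0 -> \bar R} of \d_(0 : 'rV[R]_0)].

End rV_lebesgue.

Section fractional_sobolev.
Context {R : realType} (n : nat) (s : R).
Implicit Types (u : 'rV[R]_n -> R) (Gamma : set ('rV[R]_n * 'rV[R]_n)).

Local Notation leb := (@rV_lebesgue R n).

(* The norm `|x| of the normed module 'rV[R]_n is the sup norm. *)
Definition euclid_norm (x : 'rV[R]_n) : R := Num.sqrt (\sum_i x ord0 i ^+ 2).

(* Measurability with respect to the completion of the Borel sigma-algebra. The
   integral of a nonnegative function is the supremum of the integrals of the
   simple functions below it, so for such functions it has its usual value. *)
Definition Lebesgue_measurable u : Prop :=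
  exists2 v, measurable_fun setT v & {ae leb, forall x, u x = v x}.

(* The integrand is 0 on the diagonal, since 0^-1 = 0; the diagonal is null. *)
Definition energy u Gamma : \bar R :=
  \int[(leb \x leb)%E]_(z in Gamma)
    ((u z.1 - u z.2) ^+ 2 / (euclid_norm (z.1 - z.2) `^ (n%:R + 2 * s)))%:E.

Definition sobolev_exponent : R := 2 * n%:R / (n%:R - 2 * s).

Definition integral_power u (D : set 'rV[R]_n) : \bar R :=
  \int[leb]_(x in D) (`|u x| `^ sobolev_exponent)%:E.

Definition sobolev_quotient u Gamma (D : set 'rV[R]_n) : \bar R :=
  (energy u Gamma / (integral_power u D `^ (2 / sobolev_exponent)))%E.

(* x_n, the last coordinate; the default value 0 is only used when n = 0. *)
Definition last_coord (x : 'rV[R]_n) : R :=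
  if insub n.-1 is Some i then x ord0 i else 0.

Definition upper_half : set 'rV[R]_n := [set x | 0 < last_coord x].
Definition lower_half : set 'rV[R]_n := [set x | last_coord x < 0].
Definition T_upper_half : set ('rV[R]_n * 'rV[R]_n) :=
  ~` (lower_half `*` lower_half).

Definition partial (i : 'I_n) u : 'rV[R]_n -> R :=
  fun x => 'D_(delta_mx ord0 i) u x.

Definition Cinfty u : Prop := forall l : seq 'I_n,
  let v := foldr partial u l in
  continuous v /\ forall i x, derivable v x (delta_mx ord0 i).

Definition Cc_infty u : Prop :=
  Cinfty u /\ compact (closure [set x | u x != 0]).

Definition energy_norm u : \bar R := (energy u setT `^ 2^-1)%E.

Definition energy_cauchy (phi : nat -> 'rV[R]_n -> R) : Prop :=
  forall e : R, 0 < e -> exists N : nat, forall j k : nat,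
    (N <= j)%N -> (N <= k)%N ->
    (energy_norm (fun x => phi j x - phi k x)%R < e%:E)%E.

(* The completion of C_c^infty for the energy norm, realized as a space of
   functions (up to a.e. equality): u represents the class of a Cauchy sequence
   phi when phi converges to u a.e. *)
Definition Ds u : Prop :=
  Lebesgue_measurable u /\
  exists phi : nat -> 'rV[R]_n -> R,
    [/\ forall k, Cc_infty (phi k),
        energy_cauchy phi &
        {ae leb, forall x, phi k x @[k --> \oo] --> u x}].

Definition Hs_upper_half u : Prop :=
  [/\ Lebesgue_measurable u,
      (integral_power u upper_half < +oo)%E &
      (energy u T_upper_half < +oo)%E].

Definition sobolev_const : \bar R :=
  ereal_inf [set sobolev_quotient u setT setT | u in
    [set u | Ds u /\ ~ {ae leb, forall x, u x = 0}]].

Definition neumann_sobolev_const : \bar R :=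
  ereal_inf [set sobolev_quotient u T_upper_half upper_half | u in
    [set u | Hs_upper_half u /\
             ~ {ae leb, forall x, upper_half x -> u x = 0}]].

End fractional_sobolev.

(* Main.v *)
(* Half-spaces [{x_n < t}] are stable under the boxes [prod_i ]x_i - r, x_i[], and
   on such a set D a fractional Sobolev inequality
     c I(u, D) ^ (2 / q) <= E(u, D x D),   q = 2^*_s,
   holds for every u with I(u, D) = int_D |u|^q finite. Given u on the whole
   space, slide a hyperplane until the half-space H' = {x_n < t} carries the
   fraction d of I(u), and use u, translated by t, as a competitor for the Neumann
   problem on the complementary half-space. It loses the energy E(u, H' x H'),
   which is at least c d ^ (2 / q) I(u) ^ (2 / q), whence
     (1 - d) ^ (2 / q) S_N + c d ^ (2 / q) <= S.
   As 2 / q < 1, the gain d ^ (2 / q) beats the loss 1 - (1 - d) ^ (2 / q) <= d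
   for small d, so S_N < S when S is finite. No extremal for S is needed. The case
   S = +oo only requires one competitor of finite energy for the half-space. *)
From HB Require Import structures.
Require Import Defs.
From mathcomp Require Import all_boot all_order all_algebra.
From mathcomp Require Import all_classical all_reals all_analysis.
From mathcomp Require Import measurable_realfun ring lra.

Set Implicit Arguments.
Unset Strict Implicit.
Unset Printing Implicit Defensive.

Import Order.TTheory GRing.Theory Num.Theory.
Import numFieldNormedType.Exports.

Local Open Scope classical_set_scope.
Local Open Scope ring_scope.

(** * Measure theory on row vectors *)

(** The inequality behind the gain is a bound at each point [x], integrated afterwards. It only asks
    that the boxes hanging from [x] stay in [D], so the whole space and every lower half-space are
    covered with one constant. Finiteness of the integral of [|u| ^ q] is a genuine hypothesis,
    since nonzero constants have zero energy on such sets. For a member of [Ds] it is not part of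
    the definition and must be extracted from the Cauchy sequence of test functions, whose energies
    are controlled only through differences. Cutting at a prescribed fraction [d] of the mass,
    rather than at a prescribed height, makes the coefficients of the resulting inequality
    independent of [u], which is what lets it pass to the infimum. Functions in [Ds] are Borel only
    up to a null set. Integrals are therefore compared for arbitrary nonnegative functions, and the
    geometric arguments run on a Borel representative. *)

Section integral_ae.
Context d (T : measurableType d) (R : realType).
Variable mu : {measure set T -> \bar R}.
Import HBNNSimple.
Local Open Scope ereal_scope.

(** The integral of a nonnegative function is a supremum over simple functions below it, so no
    measurability of [f] or [g] enters: a simple [h <= f], set to 0 on the exceptional null set,
    lies below [g] and keeps its integral. *)
Let ge0_ae_le_integralT (f g : T -> \bar R) :
  (forall x, 0 <= f x) -> (forall x, 0 <= g x) ->
  {ae mu, forall x, f x <= g x} -> \int[mu]_x f x <= \int[mu]_x g x.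
Proof.
move=> f0 g0 [N [mN N0 subN]].
rewrite !ge0_integralTE//; apply: ge_ereal_sup => _ [h hf <-].
rewrite -integralT_nnsfun (ge0_negligible_integral mN)//; last 2 first.
- exact/measurable_EFinP.
- by move=> x _; rewrite lee_fin.
have mNC : measurable (setT `\` N) by exact: measurableD.
rewrite (_ : integral _ _ _ = \int[mu]_x (proj_nnsfun h mNC x)%:E); last first.
  rewrite integral_mkcond; apply: eq_integral => x _.
  rewrite patchE /= mindicE.
  by case: ifPn => _; rewrite ?mulr1 ?mulr0.
rewrite integralT_nnsfun; apply: ereal_sup_ubound.
exists (proj_nnsfun h mNC) => // x /=.
rewrite mindicE; case: (boolP (x \in _)) => [/set_mem[_ Nx]|_].
  rewrite mulr1 (le_trans (hf x))//; apply: contrapT => fg; exact/Nx/subN.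
by rewrite mulr0.
Qed.

Lemma ge0_ae_le_integral (D : set T) (f g : T -> \bar R) :
  (forall x, 0 <= f x) -> (forall x, 0 <= g x) ->
  {ae mu, forall x, f x <= g x} ->
  \int[mu]_(x in D) f x <= \int[mu]_(x in D) g x.
Proof.
move=> f0 g0 fg; rewrite integral_mkcond [leRHS]integral_mkcond.
apply: ge0_ae_le_integralT.
- by move=> x; rewrite patchE; case: ifP.
- by move=> x; rewrite patchE; case: ifP.
by apply: filterS fg => x fgx; rewrite !patchE; case: ifP.
Qed.

Lemma ge0_ae_eq_integral_nomeas (D : set T) (f g : T -> \bar R) :
  (forall x, 0 <= f x) -> (forall x, 0 <= g x) ->
  {ae mu, forall x, f x = g x} ->
  \int[mu]_(x in D) f x = \int[mu]_(x in D) g x.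
Proof.
move=> f0 g0 fg; apply/eqP; rewrite eq_le; apply/andP; split;
  by apply: ge0_ae_le_integral => //; apply: filterS fg => x ->.
Qed.

Lemma ge0_le_integral_nomeas (D1 D2 : set T) (f g : T -> \bar R) :
  (forall x, 0 <= f x) -> (forall x, 0 <= g x) ->
  (forall x, D1 x -> D2 x /\ f x <= g x) ->
  \int[mu]_(x in D1) f x <= \int[mu]_(x in D2) g x.
Proof.
move=> f0 g0 fg; rewrite integral_mkcond [leRHS]integral_mkcond.
apply: ge0_ae_le_integralT.
- by move=> x; rewrite patchE; case: ifP.
- by move=> x; rewrite patchE; case: ifP.
apply: aeW => x; rewrite !patchE; case: (boolP (x \in D1)) => [/set_mem/fg[D2x fgx]|_].
  by rewrite mem_set.
by case: ifP.
Qed.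

End integral_ae.

(** Both sides are measures that agree on rectangles, which determines the product measure. *)
Lemma product_measure_pushforward d1 d2 (T1 : measurableType d1)
    (T2 : measurableType d2) (R : realType)
    (m1 : {sigma_finite_measure set T1 -> \bar R})
    (m2 : {sigma_finite_measure set T2 -> \bar R})
    (f1 : T1 -> T1) (f2 : T2 -> T2) :
  measurable_fun setT f1 -> measurable_fun setT f2 ->
  (forall A, measurable A -> m1 (f1 @^-1` A) = m1 A) ->
  (forall A, measurable A -> m2 (f2 @^-1` A) = m2 A) ->
  forall A, measurable A ->
    (m1 \x m2)%E ((fun p => (f1 p.1, f2 p.2)) @^-1` A) = (m1 \x m2)%E A.
Proof.
move=> mf1 mf2 f1E f2E A mA.
have mf : measurable_fun setT (fun p : T1 * T2 => (f1 p.1, f2 p.2)).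
  by apply/measurable_fun_pairP; split => /=;
    [exact: (measurableT_comp mf1)|exact: (measurableT_comp mf2)].
pose mfm := isMeasurableFun.Build _ _ _ _ _ mf.
pose F : {mfun _ >-> _} := HB.pack (fun p : T1 * T2 => (f1 p.1, f2 p.2)) mfm.
symmetry.
apply: (@product_measure_unique _ _ _ _ _ _ _ (pushforward (m1 \x m2)%E F)) => //.
move=> B C mB mC; rewrite /pushforward /=.
transitivity ((m1 \x m2)%E ((f1 @^-1` B) `*` (f2 @^-1` C))); first by [].
have mB' : measurable (f1 @^-1` B) by rewrite -[X in measurable X]setTI; exact: mf1.
have mC' : measurable (f2 @^-1` C) by rewrite -[X in measurable X]setTI; exact: mf2.
by rewrite [LHS]product_measure1E//; congr (_ * _)%E; [exact: f1E|exact: f2E].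
Qed.

Lemma lebesgue_measure_translation (R : realType) (a : R) (A : set R) :
  measurable A -> lebesgue_measure ((fun x => x + a) @^-1` A) = lebesgue_measure A.
Proof.
move=> mA; symmetry.
pose f (x : measurableTypeR R) : measurableTypeR R := x + a.
have mf : measurable_fun setT f by exact: (@measurable_funD _ _ R).
pose mfm := isMeasurableFun.Build _ _ _ _ _ mf.
pose F : {mfun _ >-> _} := HB.pack f mfm.
apply: (@lebesgue_measure_unique R (pushforward lebesgue_measure F)) => //= _ [[b c]] _ <-.
rewrite /pushforward /=.
rewrite (_ : _ @^-1` _ = `]b - a, c - a]%classic); last first.
  by apply/seteqP; split => x /=; rewrite !in_itv/= ltrBlDr lerBrDr.
rewrite !lebesgue_measure_itv/= !lte_fin ltrD2r.
by case: ifP => // _; rewrite -!EFinB; congr EFin; rewrite opprD opprK addrACA addNr addr0.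
Qed.

(** * Translations, boxes and hyperplanes under Lebesgue measure *)

Section rV_measure.
Context {R : realType}.

Lemma rV_lebesgue_succE n (A : set 'rV[R]_n.+1) :
  rV_lebesgue n.+1 A =
  (@lebesgue_measure R \x rV_lebesgue n)%E (@rV_cons R n @^-1` A).
Proof. by []. Qed.

Lemma measurable_rV_addr n (v : 'rV[R]_n) : measurable_fun setT (fun x : 'rV[R]_n => x + v).
Proof.
apply/measurable_fun_rVP => i.
rewrite (_ : _ \o _ = (fun x => rV_coord i x + v ord0 i)).
  by apply: measurable_funD => //; exact: measurable_rV_coord.
by apply/funext => x; rewrite /rV_coord /= mxE.
Qed.

Lemma rV_cons0 n (p : measurableTypeR R * 'rV[R]_n) : rV_cons p ord0 ord0 = p.1.
Proof.
rewrite /rV_cons (_ : ord0 = @lshift 1 n ord0); last exact/val_inj.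
by apply: etrans (row_mxEl _ _ _ _) _; rewrite mxE.
Qed.

Lemma rV_consS n (p : measurableTypeR R * 'rV[R]_n) (i : 'I_n) :
  rV_cons p ord0 (lift ord0 i) = p.2 ord0 i.
Proof.
rewrite /rV_cons (_ : lift ord0 i = @rshift 1 n i); last exact/val_inj.
exact: (row_mxEr (const_mx p.1 : 'M[R]_1)).
Qed.

Lemma rV_consD n (a : R) (v : 'rV[R]_n.+1) (y : 'rV[R]_n) :
  rV_cons (a, y) + v =
  rV_cons (a + v ord0 ord0, y + \row_i v ord0 (lift ord0 i)).
Proof.
apply/rowP => i; rewrite mxE; case: (unliftP ord0 i) => [j ->|->].
  by rewrite !rV_consS/= !mxE.
by rewrite !rV_cons0.
Qed.

Lemma rV_lebesgue_translation n (v : 'rV[R]_n) (A : set 'rV[R]_n) :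
  measurable A -> rV_lebesgue n ((fun x => x + v) @^-1` A) = rV_lebesgue n A.
Proof.
elim: n v A => [|n IHn] v A mA.
  by congr (rV_lebesgue 0 _); apply/seteqP; split => x /=; rewrite (thinmx0 (x + v)) (thinmx0 x).
pose w : 'rV[R]_n := \row_i v ord0 (lift ord0 i).
rewrite !rV_lebesgue_succE.
have mcA : measurable (@rV_cons R n @^-1` A).
  by rewrite -[X in measurable X]setTI; exact: measurable_rV_cons.
rewrite -[RHS](@product_measure_pushforward _ _ _ _ _ _ _
  (fun x : measurableTypeR R => x + v ord0 ord0 : measurableTypeR R) (fun x : 'rV[R]_n => x + w))//.
- congr ((_ \x _)%E _); apply/seteqP; split => -[a x] /=;
    by rewrite rV_consD.
- exact: (@measurable_funD _ _ R).
- exact: measurable_rV_addr.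
- by move=> B mB; exact: lebesgue_measure_translation.
- by move=> B mB; exact: IHn.
Qed.

Lemma rV_lebesgue2_translation n (v : 'rV[R]_n) (A : set ('rV[R]_n * 'rV[R]_n)) :
  measurable A ->
  (rV_lebesgue n \x rV_lebesgue n)%E ((fun z => (z.1 + v, z.2 + v)) @^-1` A) =
  (rV_lebesgue n \x rV_lebesgue n)%E A.
Proof.
move=> mA; apply: (@product_measure_pushforward _ _ _ _ _ _ _
  (fun x : 'rV[R]_n => x + v) (fun x : 'rV[R]_n => x + v)) => //; [exact: measurable_rV_addr..| |];
  by move=> B mB; exact: rV_lebesgue_translation.
Qed.

Definition box n (x : 'rV[R]_n) (r : R) : set 'rV[R]_n :=
  [set y | forall i, x ord0 i - r < y ord0 i < x ord0 i].

Lemma rV_cons_box n (x : 'rV[R]_n.+1) r :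
  @rV_cons R n @^-1` box x r =
  `]x ord0 ord0 - r, x ord0 ord0[%classic `*` box (\row_i x ord0 (lift ord0 i)) r.
Proof.
apply/seteqP; split => -[a y] /=.
  move=> H; split => [|i] /=; first by have := H ord0; rewrite rV_cons0/= in_itv.
  by have := H (lift ord0 i); rewrite rV_consS mxE.
move=> [H1 H2] i; case: (unliftP ord0 i) => [j ->|->].
  by have := H2 j; rewrite rV_consS mxE.
by move: H1; rewrite rV_cons0 in_itv.
Qed.

Lemma measurable_box n (x : 'rV[R]_n) r : measurable (box x r).
Proof.
rewrite (_ : box x r = \big[setI/setT]_(i < n)
  (rV_coord i @^-1` `]x ord0 i - r, x ord0 i[%classic)); last first.
  rewrite -bigcap_seq; apply/seteqP; split => y /=.
    by move=> H i _ /=; rewrite in_itv/=; exact: H.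
  by move=> H i; have := H i (mem_index_enum i); rewrite /= in_itv.
apply: bigsetI_measurable => i _.
by rewrite -[X in measurable X]setTI; apply: measurable_rV_coord.
Qed.

Lemma rV_lebesgue_box n (x : 'rV[R]_n) (r : R) : 0 <= r ->
  rV_lebesgue n (box x r) = (r ^+ n)%:E.
Proof.
move=> r0; elim: n x => [|n IHn] x.
  by rewrite /= diracE mem_set// => -[].
rewrite rV_lebesgue_succE rV_cons_box product_measure1E//; last exact: measurable_box.
rewrite exprS EFinM -(IHn (\row_i x ord0 (lift ord0 i))); congr (_ * _)%E.
rewrite [LHS](lebesgue_measure_itv `]x ord0 ord0 - r, x ord0 ord0[)/= lte_fin ltrBlDr ltrDl.
case: ifPn => [_|]; first by rewrite -EFinB opprB addrC subrK.
by rewrite -leNgt => r0'; congr EFin; apply/eqP; rewrite eq_le r0 r0'.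
Qed.

Lemma last_coord_rV_cons n (p : measurableTypeR R * 'rV[R]_n.+1) :
  last_coord (rV_cons p) = last_coord p.2.
Proof.
rewrite /last_coord; case: insubP => [i _ iE|]; last by rewrite ltnSn.
case: insubP => [j _ jE|]; last by rewrite ltnSn.
rewrite -rV_consS; congr (rV_cons p _ _); apply: val_inj => /=.
by rewrite iE /bump /= jE.
Qed.

Lemma last_coordE n (x : 'rV[R]_n.+1) : last_coord x = x ord0 ord_max.
Proof.
rewrite /last_coord; case: insubP => [i _ iE|]; last by rewrite ltnSn.
by congr (x _ _); exact: val_inj.
Qed.

Lemma measurable_last_coord n : measurable_fun setT (@last_coord R n.+1).
Proof.
rewrite (_ : last_coord (n := n.+1) = rV_coord ord_max); first exact: measurable_rV_coord.
by apply/funext => x; exact: last_coordE.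
Qed.

(** [rV_cons] prepends a coordinate, so the induction strips first coordinates until only the last
    one remains; the set is then a point times the zero-dimensional space. *)
Lemma rV_lebesgue_hyperplane n (t : R) :
  rV_lebesgue n.+1 [set x | last_coord x = t] = 0%E.
Proof.
elim: n => [|n IHn]; rewrite rV_lebesgue_succE.
  rewrite (_ : _ @^-1` _ = [set t] `*` setT); last first.
    apply/seteqP; split => -[a x] /=; rewrite last_coordE.
      by rewrite (_ : ord_max = ord0) ?rV_cons0//; exact: val_inj.
    by move=> [<- _]; rewrite (_ : ord_max = ord0) ?rV_cons0//; exact: val_inj.
  rewrite product_measure1E// -[RHS](mul0e (rV_lebesgue 0 setT)).
  by congr (_ * _)%E; exact: lebesgue_measure_set1.
rewrite (_ : _ @^-1` _ = setT `*` [set x | last_coord x = t]); last first.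
  by apply/seteqP; split => -[a x] /=; rewrite last_coord_rV_cons// => -[].
rewrite product_measure1E//; first by rewrite IHn mule0.
by rewrite -[X in measurable X]setTI;
  exact: (measurable_last_coord measurableT (measurable_set1 t)).
Qed.

End rV_measure.

(** * Borel measurability of the kernel *)

Section fractional_kernel.
Context {R : realType} (n : nat).
Implicit Types (u : 'rV[R]_n -> R).

(** The sigma-algebra is generated by the coordinates, not by the open sets, so [u] is written as a
    limit: rounding each coordinate down to the grid of mesh [1 / (k + 1)] gives a function that is
    constant on each of countably many measurable cells, and continuity gives convergence as [k]
    grows. *)
Lemma continuous_measurable_rV u : continuous u -> measurable_fun setT u.
Proof.
move=> cu.
pose g (k : nat) (x : 'rV[R]_n) : 'rV[int]_n := \row_i Num.floor (x ord0 i * k.+1%:R).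
pose h (k : nat) (p : 'rV[int]_n) : 'rV[R]_n := \row_i ((p ord0 i)%:~R / k.+1%:R).
apply: (@measurable_fun_cvg _ _ _ _ (fun k x => u (h k (g k x)))) => [k|x _].
  move=> _ Y mY; rewrite setTI.
  rewrite (_ : _ @^-1` _ = \bigcup_p (g k @^-1` [set p] `&` [set x | Y (u (h k p))])); last first.
    apply/seteqP; split => x /=; first by move=> Yx; exists (g k x).
    by move=> [p _ [/= <-]].
  apply: countable_bigcupT_measurable => [|p]; first exact: countableP.
  have [Yp|nYp] := pselect (Y (u (h k p))); last first.
    by rewrite (_ : [set x | _] = set0) ?setI0// -subset0 => x.
  rewrite (_ : [set x | Y (u (h k p))] = setT) ?setIT; last by apply/seteqP; split.
  rewrite (_ : _ @^-1` _ = \big[setI/setT]_(i < n)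
     (rV_coord i @^-1` `[(p ord0 i)%:~R / k.+1%:R, (p ord0 i + 1)%:~R / k.+1%:R[%classic)).
    apply: bigsetI_measurable => i _.
    by rewrite -[X in measurable X]setTI; apply: measurable_rV_coord.
  have k0 : 0 < k.+1%:R :> R by rewrite ltr0n.
  rewrite -bigcap_seq; apply/seteqP; split => y /=.
    move=> /rowP H i _ /=; have := H i; rewrite mxE => <-; rewrite in_itv/=.
    rewrite ler_pdivrMr// ltr_pdivlMr//; exact: floor_itv.
  move=> H; apply/rowP => i; rewrite mxE; apply: floor_def.
  have := H i (mem_index_enum i); rewrite /= in_itv/= ler_pdivrMr// ltr_pdivlMr//.
apply: continuous_cvg; first exact: cu.
apply/(@cvgrPdist_le R 'rV[R]_n) => e e0.
near=> k.
have k0 : 0 < k.+1%:R :> R by rewrite ltr0n.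
rewrite [leLHS]/Num.norm/= mx_normrE; apply/bigmax_leP; split => [|[i j] _ /=]; first exact: ltW.
rewrite !mxE (ord1 i).
have /andP[fl fr] := floor_itv (x ord0 j * k.+1%:R).
have k1 : k.+1%:R^-1 < e by near: k; exact: (near_infty_natSinv_lt (PosNum e0)).
rewrite ger0_norm; last by rewrite subr_ge0 ler_pdivrMr.
apply: le_trans (ltW k1); rewrite lerBlDr -(ler_pM2r k0) mulrDl mulVf ?gt_eqF// divfK ?gt_eqF//.
by rewrite addrC -[1]/(1%:~R) -intrD ltW.
Unshelve. all: by end_near. Qed.

Lemma euclid_norm_ge0 (x : 'rV[R]_n) : 0 <= euclid_norm x.
Proof. exact: sqrtr_ge0. Qed.

Lemma coord_le_euclid_norm (x : 'rV[R]_n) i : `|x ord0 i| <= euclid_norm x.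
Proof.
rewrite -sqrtr_sqr ler_wsqrtr// (bigD1 i)//= lerDl sumr_ge0// => j _.
exact: sqr_ge0.
Qed.

Lemma euclid_norm_gt0 (x : 'rV[R]_n) : x != 0 -> 0 < euclid_norm x.
Proof.
move=> x0; rewrite lt_neqAle euclid_norm_ge0 andbT eq_sym.
apply: contra x0 => /eqP x0; apply/eqP/rowP => i; rewrite mxE; apply/eqP.
by rewrite -normr_eq0 eq_le normr_ge0 andbT -x0 coord_le_euclid_norm.
Qed.

Lemma normr_le_euclid_norm (x : 'rV[R]_n) : `|x| <= euclid_norm x.
Proof.
rewrite [leLHS]/Num.norm/= mx_normrE; apply/bigmax_leP; split => [|[i j] _ /=].
  exact: euclid_norm_ge0.
by rewrite (ord1 i) coord_le_euclid_norm.
Qed.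

Lemma euclid_norm_le (x : 'rV[R]_n) (r : R) : 0 <= r ->
  (forall i, `|x ord0 i| <= r) -> euclid_norm x <= Num.sqrt n%:R * r.
Proof.
move=> r0 xr; rewrite -[X in _ * X](ger0_norm r0) -sqrtr_sqr -sqrtrM// ler_wsqrtr//.
rewrite (le_trans (_ : _ <= \sum_(i < n) r ^+ 2))//; last first.
  by rewrite sumr_const card_ord mulr_natl.
by apply: ler_sum => i _; rewrite -(real_normK (num_real (x ord0 i))) lerXn2r ?nnegrE// xr.
Qed.

Definition frac_kernel (s : R) u (z : 'rV[R]_n * 'rV[R]_n) : R :=
  (u z.1 - u z.2) ^+ 2 / (euclid_norm (z.1 - z.2) `^ (n%:R + 2 * s)).

Lemma frac_kernel_ge0 s u z : 0 <= frac_kernel s u z.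
Proof. by rewrite divr_ge0 ?sqr_ge0 ?powR_ge0. Qed.

Lemma measurable_euclid_norm_sub :
  measurable_fun setT (fun z : 'rV[R]_n * 'rV[R]_n => euclid_norm (z.1 - z.2)).
Proof.
rewrite (_ : (fun z => _) = fun z : 'rV[R]_n * 'rV[R]_n =>
    (\sum_(i < n) (rV_coord i z.1 - rV_coord i z.2) ^+ 2) `^ 2^-1).
  apply: (measurableT_comp (measurable_powR _)).
  apply: measurable_sum => i; apply: measurable_funX; apply: measurable_funB.
    by apply: measurableT_comp => //; exact: measurable_rV_coord.
  by apply: measurableT_comp => //; exact: measurable_rV_coord.
apply/funext => z; rewrite powR12_sqrt; last by apply: sumr_ge0 => i _; exact: sqr_ge0.
by rewrite /euclid_norm; congr Num.sqrt; apply: eq_bigr => i _; rewrite !mxE.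
Qed.

Lemma measurable_frac_kernel s u : measurable_fun setT u ->
  measurable_fun setT (frac_kernel s u).
Proof.
move=> mu; apply: measurable_funM.
  apply: measurable_funX; apply: measurable_funB; exact: measurableT_comp.
rewrite (_ : (fun z => _) = fun z : 'rV[R]_n * 'rV[R]_n =>
  euclid_norm (z.1 - z.2) `^ (- (n%:R + 2 * s))).
  apply: (measurableT_comp (measurable_powR _)); exact: measurable_euclid_norm_sub.
by apply/funext => z; rewrite powRN.
Qed.

End fractional_kernel.

(** * The fractional Sobolev inequality *)

Section fractional_sobolev_inequality.
Context {R : realType} (n : nat) (s : R).
Hypotheses (s_gt0 : 0 < s) (sn : 2 * s < n%:R).
Implicit Types (u : 'rV[R]_n -> R) (D : set 'rV[R]_n).

Local Notation q := (sobolev_exponent n s).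
Local Notation leb := (@rV_lebesgue R n).

Let n_gt0 : 0 < n%:R :> R.
Proof. by rewrite (lt_trans _ sn)// mulr_gt0. Qed.

Let ns_gt0 : 0 < n%:R - 2 * s.
Proof. by rewrite subr_gt0. Qed.

Lemma sobolev_exponent_gt0 : 0 < q.
Proof. by rewrite divr_gt0// mulr_gt0. Qed.

Let b := 2 * s / n%:R.

Lemma two_div_sobolev_exponent : 2 / q = 1 - b.
Proof. by rewrite /b /sobolev_exponent; field; rewrite !gt_eqF. Qed.

Lemma sobolev_exponent_eq : q = 2 + q * b.
Proof. by rewrite /b /sobolev_exponent; field; rewrite !gt_eqF. Qed.

Lemma measurable_norm_power u : measurable_fun setT u ->
  measurable_fun setT (fun x => (`|u x| `^ q)%:E).
Proof.
move=> mu; apply/measurable_EFinP; apply: (measurableT_comp (measurable_powR _)).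
exact: measurableT_comp.
Qed.

Lemma chebyshev_power u D (t I : R) : measurable_fun setT u -> measurable D ->
  0 < t -> (integral_power s u D <= I%:E)%E ->
  (leb (D `&` [set x | (t < `|u x|)%R]) <= (I / t `^ q)%:E)%E.
Proof.
move=> mu mD t0 uI.
have tq0 : 0 < t `^ q by rewrite powR_gt0.
have mA : measurable (D `&` [set x | t < `|u x|]).
  apply: measurableI => //; rewrite -[X in measurable X]setTI.
  rewrite (_ : [set x | _] = (fun x => `|u x|) @^-1` `]t, +oo[%classic).
    by apply: (measurableT_comp _ mu) => //; exact: measurable_itv.
  by apply/seteqP; split => x /=; rewrite in_itv/= andbT.
rewrite EFinM muleC lee_pdivlMl//.
apply: le_trans uI; rewrite -integral_cst//; apply: ge0_le_integral_nomeas.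
- by move=> x; rewrite lee_fin ltW.
- by move=> x; rewrite lee_fin powR_ge0.
move=> x [Dx /= tx]; split => //.
by rewrite lee_fin; apply: ge0_ler_powR; rewrite ?nnegrE ?normr_ge0 ?(ltW t0) ?(ltW tx) ?(ltW sobolev_exponent_gt0).
Qed.

(** The factors come from the proof below: [4^-1] from [(|u x| / 2) ^ 2], the power of [sqrt n] from
    the Euclidean size [sqrt n * r] of a box of side [r], [2 ^ (-1 - b)] from the measure [2M] of
    that box, and [2 ^ (- q b)] from the Chebyshev threshold [|u x| / 2]. *)
Definition sobolev_cst : R :=
  4^-1 * (Num.sqrt n%:R `^ (n%:R + 2 * s))^-1 * 2 `^ (- 1 - b) * 2 `^ (- (q * b)).

Lemma sobolev_cst_gt0 : 0 < sobolev_cst.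
Proof. by rewrite !mulr_gt0 ?invr_gt0 ?powR_gt0// sqrtr_gt0. Qed.

(* The box [box x r] is taken of measure [2M], so that by Chebyshev [|u| <= |u x| / 2]
   on at least half of it; there [|u x - u y| >= |u x| / 2], and the powers of
   [|u x|] combine to [|u x| ^ q]. *)
Lemma power_le_fiber_energy u D (I : R) x :
  measurable_fun setT u -> measurable D ->
  (forall r, 0 < r -> box x r `<=` D) ->
  0 < I -> (integral_power s u D <= I%:E)%E ->
  ((sobolev_cst * I `^ (- b) * `|u x| `^ q)%:E <=
   \int[leb]_(y in D) (frac_kernel s u (x, y))%:E)%E.
Proof.
move=> mu mD boxD I0 uI.
have [ux0|ux0] := eqVneq (u x) 0.
  rewrite ux0 normr0 powR0 ?mulr0 ?gt_eqF ?sobolev_exponent_gt0//.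
  by apply: integral_ge0 => y _; rewrite lee_fin frac_kernel_ge0.
pose a := `|u x|.
have a0 : 0 < a by rewrite normr_gt0.
pose M := I / (a / 2) `^ q.
have M0 : 0 < M by rewrite divr_gt0// powR_gt0// divr_gt0.
have M20 : 0 < 2 * M by rewrite mulr_gt0.
pose r := (2 * M) `^ (n%:R^-1).
have r0 : 0 < r by rewrite powR_gt0.
have rn : r ^+ n = 2 * M.
  by rewrite -powR_mulrn ?ltW// -powRrM mulVf ?gt_eqF// powRr1 ?ltW.
pose B := box x r.
pose W := [set y | a / 2 < `|u y|].
have mW : measurable W.
  rewrite -[X in measurable X]setTI.
  rewrite (_ : W = (fun x => `|u x|) @^-1` `]a / 2, +oo[%classic).
    by apply: (measurableT_comp _ mu) => //; exact: measurable_itv.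
  by apply/seteqP; split => y /=; rewrite in_itv/= andbT.
have mB : measurable B by exact: measurable_box.
have lebBW : (leb (B `&` W) <= M%:E)%E.
  apply: le_trans (chebyshev_power mu mD _ uI) => //; last by rewrite divr_gt0.
  by apply: le_measure; rewrite ?inE; [exact: measurableI..|apply: setSI; exact: boxD].
have lebA : (M%:E <= leb (B `\` W))%E.
  rewrite -(@leeD2rE _ M%:E)// -EFinD -mulr2n -mulr_natl -rn.
  rewrite -(rV_lebesgue_box x (ltW r0)) -/B (measureDI leb mB mW) leeD2l//.
pose k0 := (a ^+ 2 / 4) / (Num.sqrt n%:R * r) `^ (n%:R + 2 * s).
have sq0 : 0 < Num.sqrt n%:R * r by rewrite mulr_gt0// sqrtr_gt0.
have k00 : 0 < k0 by rewrite !divr_gt0 ?powR_gt0// exprn_gt0.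
have kA y : (B `\` W) y -> k0 <= frac_kernel s u (x, y).
  move=> [By /= /negP]; rewrite -leNgt => uya.
  have xy : a / 2 <= `|u x - u y|.
    rewrite (le_trans _ (lerB_dist _ _))// lerBrDr.
    by rewrite (le_trans (lerD (lexx _) uya))// -splitr.
  rewrite /frac_kernel/=; apply: ler_pM.
  - by rewrite divr_ge0 ?sqr_ge0.
  - by rewrite invr_ge0 powR_ge0.
  - rewrite -(real_normK (num_real (u x - u y))).
    rewrite (_ : a ^+ 2 / 4 = (a / 2) ^+ 2); last by field.
    by rewrite lerXn2r ?nnegrE// divr_ge0 ?ltW.
  have eu : 0 < euclid_norm (x - y).
    apply: euclid_norm_gt0; rewrite subr_eq0; apply/eqP => xyE.
    by move: xy; rewrite xyE subrr normr0 leNgt divr_gt0.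
  rewrite lef_pV2 ?posrE ?powR_gt0// ge0_ler_powR ?nnegrE ?euclid_norm_ge0 ?(ltW sq0)//.
    by rewrite ltW// addr_gt0// mulr_gt0.
  apply: euclid_norm_le => [|i]; first exact: ltW.
  have /andP[y1 y2] := By i; rewrite !mxE ger0_norm; last by rewrite subr_ge0 ltW.
  by rewrite lerBlDr -lerBlDl ltW.
apply: le_trans (_ : (k0%:E * leb (B `\` W) <= _)%E); last first.
  rewrite -integral_cst; last exact: measurableD.
  apply: ge0_le_integral_nomeas => y.
  - by rewrite lee_fin ltW.
  - by rewrite lee_fin frac_kernel_ge0.
  by move=> BWy; split; [case: BWy => /(boxD _ r0)|rewrite lee_fin kA].
apply: le_trans (lee_wpmul2l _ lebA); last by rewrite lee_fin ltW.
rewrite -EFinM lee_fin le_eqVlt; apply/orP; left; apply/eqP.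
(* Since [r ^ n = 2M], the kernel bound scales like [M ^ (-(1 + b))]; multiplied by the measure [M]
   it leaves [M ^ (-b)], which supplies the factor [a ^ (q b)] missing from [a ^ 2]. *)
have p_n : n%:R + 2 * s = n%:R * (1 + b).
  by rewrite /b mulrDr mulr1 mulrCA divff ?mulr1 ?gt_eqF.
have -> : k0 = a ^+ 2 / 4 * ((Num.sqrt n%:R `^ (n%:R + 2 * s))^-1 * (2 * M) `^ (- (1 + b))).
  rewrite /k0; congr (_ * _).
  rewrite (@powRM _ (Num.sqrt n%:R) r) ?sqrtr_ge0 ?(ltW r0)// invfM; congr (_ * _).
  by rewrite powRN {1}p_n /r -powRrM mulrA mulVf ?gt_eqF// mul1r.
have -> : (2 * M) `^ (- (1 + b)) = 2 `^ (- 1 - b) * (M^-1 * M `^ (- b)).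
  rewrite powRM ?ltW// -opprD; congr (_ * _).
  rewrite -(powR_inv1 (ltW M0)) -powRD; first by rewrite opprD.
  by rewrite (gt_eqF M0) implybT.
have -> : M `^ (- b) = I `^ (- b) * (a `^ (q * b) * 2 `^ (- (q * b))).
  rewrite /M powRM ?invr_ge0 ?powR_ge0 ?ltW//; congr (_ * _).
  rewrite -[X in X `^ _]powRN -powRrM mulrNN.
  rewrite powRM ?invr_ge0 ?ltW//; congr (_ * _).
  by rewrite -(@powR_inv1 _ 2)// -powRrM mulN1r.
have -> : a `^ q = a ^+ 2 * a `^ (q * b).
  rewrite {1}sobolev_exponent_eq powRD ?(gt_eqF a0) ?implybT// -powR_mulrn ?ltW//.
rewrite /sobolev_cst; field.
by rewrite !gt_eqF ?powR_gt0 ?sqrtr_gt0.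
Qed.

End fractional_sobolev_inequality.

(** * The integrated inequality and finiteness of the power integral *)

Section fractional_sobolev_integrated.
Context {R : realType} (n : nat) (s : R).
Hypotheses (s_gt0 : 0 < s) (sn : 2 * s < n%:R).
Implicit Types (u : 'rV[R]_n -> R) (D : set 'rV[R]_n).

Local Notation q := (sobolev_exponent n s).
Local Notation leb := (@rV_lebesgue R n).
Local Notation c := (sobolev_cst n s).

Lemma integral_power_ge0 u D : (0 <= integral_power s u D)%E.
Proof. by apply: integral_ge0 => x _; rewrite lee_fin powR_ge0. Qed.

Lemma energy_ge0 u Gamma : (0 <= energy s u Gamma)%E.
Proof. by apply: integral_ge0 => x _; exact: (frac_kernel_ge0 s u). Qed.

Lemma energyX u D : measurable_fun setT u -> measurable D ->
  (energy s u (D `*` D) =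
   \int[leb]_(x in D) \int[leb]_(y in D) (frac_kernel s u (x, y))%:E)%E.
Proof.
move=> mu mD.
have mDD : measurable (D `*` D) by exact: measurableX.
rewrite [LHS]integral_mkcond fubini_tonelli1; first last.
- by move=> z; rewrite patchE; case: ifP => // _; exact: (frac_kernel_ge0 s u).
- apply/(measurable_restrictT _ mDD)/measurable_EFinP.
  apply: measurable_funTS; exact: (measurable_frac_kernel s mu).
rewrite [RHS]integral_mkcond; apply: eq_integral => x _.
rewrite /fubini_F patchE; case: (boolP (x \in D)) => xD.
  rewrite [RHS]integral_mkcond; apply: eq_integral => y _.
  by rewrite !patchE in_setX/= xD.
rewrite -[RHS](integral0 leb setT); apply: eq_integral => y _.
by rewrite patchE in_setX/= (negbTE xD).
Qed.

(** Integrating the bound at [x] over [D] produces [I ^ (-b)] times [I], that is [I ^ (2 / q)]. The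
    case [I = 0] is set apart because of the negative power. *)
Lemma fractional_sobolev u D : measurable_fun setT u -> measurable D ->
  (forall x r, D x -> 0 < r -> box x r `<=` D) ->
  (integral_power s u D < +oo)%E ->
  (c%:E * integral_power s u D `^ (2 / q) <= energy s u (D `*` D))%E.
Proof.
move=> mu mD boxD.
have := integral_power_ge0 u D.
case E : (integral_power s u D) => [I| |]//; rewrite lee_fin => I_ge0 _.
have [I0|I0] := eqVneq I 0.
  rewrite I0 poweR0r ?mule0 ?energy_ge0// gt_eqF// divr_gt0//.
  exact: sobolev_exponent_gt0.
have I_gt0 : 0 < I by rewrite lt_def I0.
set b := 2 * s / n%:R.
have -> : (c%:E * I%:E `^ (2 / q) = (c * I `^ (- b))%:E * I%:E)%E.
  rewrite two_div_sobolev_exponent// poweR_EFin -!EFinM; congr EFin.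
  rewrite -[RHS]mulrA; congr (_ * _).
  rewrite addrC powRD ?(gt_eqF I_gt0) ?implybT//.
  by rewrite powRr1.
have cI0 : 0 <= c * I `^ (- b) by rewrite mulr_ge0 ?powR_ge0// ltW// sobolev_cst_gt0.
have f0 x : D x -> (0 <= (`|u x| `^ q)%:E)%E by rewrite lee_fin powR_ge0.
have mf : measurable_fun D (fun x => (`|u x| `^ q)%:E).
  by apply: measurable_funTS; exact: measurable_norm_power.
rewrite -E /integral_power -(ge0_integralZl_EFin _ mD f0 mf cI0).
rewrite energyX//; apply: ge0_le_integral_nomeas => x.
- by rewrite mule_ge0// lee_fin powR_ge0.
- by apply: integral_ge0 => y _; exact: frac_kernel_ge0.
move=> Dx; split => //; rewrite -EFinM; apply: power_le_fiber_energy => //.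
  by move=> r; exact: boxD.
by rewrite E.
Qed.

Lemma fractional_sobolevT u : measurable_fun setT u ->
  (integral_power s u setT < +oo)%E ->
  (c%:E * integral_power s u setT `^ (2 / q) <= energy s u setT)%E.
Proof.
by move=> mu Ioo; have := @fractional_sobolev u setT mu measurableT (fun _ _ _ _ _ _ => I) Ioo; rewrite setXTT.
Qed.

Lemma powR_normD (a b p : R) : 0 < p ->
  `|a + b| `^ p <= 2 `^ p * (`|a| `^ p + `|b| `^ p).
Proof.
move=> p0.
wlog ab : a b / `|a| <= `|b|.
  move=> H; case: (leP `|a| `|b|) => [/H//|/ltW/H].
  by rewrite (addrC b) [X in _ * X]addrC.
apply: le_trans (_ : (2 * `|b|) `^ p <= _).
  apply: ge0_ler_powR; rewrite ?nnegrE ?mulr_ge0// ?(ltW p0)//.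
  by rewrite mulr_natl mulr2n (le_trans (ler_normD _ _))// lerD2r.
by rewrite powRM// ler_pM2l ?powR_gt0// lerDr powR_ge0.
Qed.

Lemma integral_power_lty u : continuous u -> compact (closure [set x | u x != 0]) ->
  (integral_power s u setT < +oo)%E.
Proof.
move=> cu csupp.
have [r [r0 suppr]] : exists r : R, 0 < r /\ forall x, u x != 0 -> `|x| < r.
  have [M [_ Mb]] := compact_bounded csupp.
  exists (`|M| + 2); split; first by rewrite ltr_wpDl.
  move=> x ux; apply: (@le_lt_trans _ _ (`|M| + 1)); last by rewrite ltrD2l ltr1n.
  by apply: Mb; [rewrite (le_lt_trans (ler_norm M))// ltrDl|exact: subset_closure].
have [C [C0 uC]] : exists C : R, 0 <= C /\ forall x, `|u x| <= C.
  have cimg : compact (u @` closure [set x | u x != 0]).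
    by apply: continuous_compact => //; exact: continuous_subspaceT.
  have [M [_ Mb]] := compact_bounded cimg.
  exists (`|M| + 1); split; first by rewrite addr_ge0.
  move=> x; have [->|ux] := eqVneq (u x) 0; first by rewrite normr0 addr_ge0.
  apply: Mb; first by rewrite (le_lt_trans (ler_norm M))// ltrDl.
  by exists x => //; exact: subset_closure.
(* The box with upper corner [(r, ..., r)] and side [2r] is the cube []-r, r[ ^ n], which contains
   every point where [u] is nonzero. *)
apply: (@le_lt_trans _ _ (\int[leb]_(x in box (const_mx r) (2 * r)) (C `^ q)%:E)%E).
  apply: le_trans (_ : (\int[leb]_(x in [set x | u x != 0%R]) (`|u x| `^ q)%:E <= _)%E).
    rewrite /integral_power [leRHS]integral_mkcond; apply: ge0_le_integral_nomeas => x.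
    - by rewrite lee_fin powR_ge0.
    - by rewrite patchE; case: ifP => //; rewrite lee_fin powR_ge0.
    move=> _; split => //; rewrite patchE; case: ifPn => // /negP.
    rewrite inE/= => /negP; rewrite negbK => /eqP ->.
    by rewrite normr0 powR0// gt_eqF// sobolev_exponent_gt0.
  apply: ge0_le_integral_nomeas => x; rewrite ?lee_fin ?powR_ge0//= => ux; split.
    move=> i; rewrite !mxE mulrDl mul1r opprD addrA subrr sub0r.
    rewrite -ltr_norml (le_lt_trans _ (suppr x ux))//.
    rewrite [leRHS]/Num.norm/= mx_normrE.
    exact: (le_bigmax _ (fun ij : 'I_1 * 'I_n => `|x ij.1 ij.2|) (ord0, i)).
  apply: ge0_ler_powR; rewrite ?nnegrE// ltW//.
  exact: sobolev_exponent_gt0.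
rewrite integral_cst; last exact: measurable_box.
by rewrite [X in (_ * X)%E](rV_lebesgue_box _ (_ : 0 <= 2 * r)) ?mulr_ge0 ?(ltW r0)// -EFinM ltry.
Qed.

Lemma integral_power_lty_sub u (v : 'rV[R]_n -> R) : measurable_fun setT u -> measurable_fun setT v ->
  (integral_power s (fun x => u x - v x)%R setT < +oo)%E ->
  (integral_power s v setT < +oo)%E -> (integral_power s u setT < +oo)%E.
Proof.
move=> mu mv uvoo voo.
have q0 := sobolev_exponent_gt0 s_gt0 sn.
have q20 : 0 <= 2 `^ q :> R by rewrite powR_ge0.
have muv : measurable_fun setT (fun x => u x - v x) by exact: measurable_funB.
apply: (@le_lt_trans _ _ ((2 `^ q)%:E *
   (integral_power s (fun x => u x - v x)%R setT + integral_power s v setT))%E); last first.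
  by rewrite lte_mul_pinfty ?lee_fin// lte_add_pinfty.
have p0 (w : 'rV[R]_n -> R) x : setT x -> (0 <= (`|w x| `^ q)%:E)%E.
  by rewrite lee_fin powR_ge0.
have m1 := measurable_norm_power s muv.
have m2 := measurable_norm_power s mv.
rewrite /integral_power -(ge0_integralD _ measurableT (p0 _) m1 (p0 _) m2).
rewrite -(ge0_integralZl_EFin _ measurableT _ (emeasurable_funD m1 m2) q20); last first.
  by move=> x _; rewrite adde_ge0 ?p0.
apply: ge0_le_integral_nomeas => x; first exact: p0.
  by rewrite mule_ge0 ?adde_ge0 ?p0.
move=> _; split => //; rewrite -EFinD -EFinM lee_fin.
by rewrite -{1}(subrK (v x) (u x)) powR_normD.
Qed.

End fractional_sobolev_integrated.

(** * Finite power integral for members of [Ds] *)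

Section Ds_integrability.
Context {R : realType} (n : nat) (s : R).
Hypotheses (s_gt0 : 0 < s) (sn : 2 * s < n%:R).
Implicit Types (u v : 'rV[R]_n -> R).

Local Notation q := (sobolev_exponent n s).
Local Notation leb := (@rV_lebesgue R n).

Lemma limn_einf_ge0 (a : (\bar R)^nat) : (forall k, 0 <= a k)%E -> (0 <= limn_einf a)%E.
Proof.
move=> a0; rewrite limn_einf_lim; apply: lime_ge; first exact: is_cvg_einfs.
by apply: nearW => k; apply: le_ereal_inf_tmp => _ [m _ <-].
Qed.

Lemma limn_einf_le (a : (\bar R)^nat) (K : \bar R) :
  (forall k, a k <= K)%E -> (limn_einf a <= K)%E.
Proof.
move=> aK; rewrite limn_einf_lim; apply: lime_le; first exact: is_cvg_einfs.
apply: nearW => k; apply: le_trans (aK k); apply: ereal_inf_lbound.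
by exists k => //=.
Qed.

(** This is the pointwise input of Fatou's lemma. Continuity of the power is invoked only at
    [|l| > 0]; at [l = 0] the left side vanishes and the right side is nonnegative. *)
Lemma power_le_limn_einf (a : R^nat) (l p : R) : 0 < p -> a @ \oo --> l ->
  ((`|l| `^ p)%:E <= limn_einf (fun k => (`|a k| `^ p)%:E))%E.
Proof.
move=> p0 al; have [->|l0] := eqVneq l 0.
  rewrite normr0 powR0 ?gt_eqF//; apply: limn_einf_ge0 => k.
  by rewrite lee_fin powR_ge0.
have nl0 : 0 < `|l| by rewrite normr_gt0.
have cpow : {for `|l|, continuous (fun x : R => x `^ p)}.
  apply: differentiable_continuous; apply/derivable1_diffP/derivable_powR.
  by rewrite in_itv/= nl0.
have : (`|a k| `^ p)%:E @[k --> \oo] --> (`|l| `^ p)%:E.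
  apply: cvg_EFin; first exact: nearW.
  by apply: (continuous_cvg _ cpow); exact: cvg_norm.
by move=> /cvg_limn_einf_sup[->].
Qed.

(* Only the differences [phi j - phi k] need finite energy; the integrability of
   [phi N] itself comes from its compact support. *)
Lemma Ds_integral_power_lty u v : Ds s u -> measurable_fun setT v ->
  {ae leb, forall x, u x = v x} -> (integral_power s v setT < +oo)%E.
Proof.
move=> [_ [phi [Cphi cauchy phiu]]] mv uv.
have q0 := sobolev_exponent_gt0 s_gt0 sn.
have c0 := sobolev_cst_gt0 s_gt0 sn.
have cphi k : continuous (phi k) by have [/(_ [::])[]] := Cphi k.
have mphi k : measurable_fun setT (phi k) by exact: continuous_measurable_rV.
have phioo k : (integral_power s (phi k) setT < +oo)%E.
  by apply: integral_power_lty => //; have [] := Cphi k.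
have [N HN] := cauchy 1 ltr01.
pose w k x := phi (k + N)%N x - phi N x.
have mw k : measurable_fun setT (w k) by exact: measurable_funB.
(* Energy at most 1 and the Sobolev inequality give [I ^ (2 / q) <= c^-1] for the power integral [I]
   of each [w k]; [K] is the resulting bound on [I]. *)
pose K := (sobolev_cst n s)^-1 `^ (q / 2).
have wK k : (integral_power s (w k) setT <= K%:E)%E.
  have Ioo : (integral_power s (w k) setT < +oo)%E.
    apply: (@integral_power_lty_sub _ _ _ s_gt0 sn _ (fun x => - phi N x)) => //.
    - exact: measurableT_comp.
    - rewrite (_ : (fun x => _) = phi (k + N)%N)//.
      by apply/funext => x; rewrite /w opprK subrK.
    - rewrite /integral_power; under eq_integral do rewrite normrN.
      exact: phioo.
  have E1 : (energy s (w k) setT <= 1)%E.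
    have := HN (k + N)%N N (leq_addl _ _) (leqnn _).
    rewrite /energy_norm -/(w k).
    have := energy_ge0 s (w k) setT.
    case: (energy s (w k) setT) => [e| |]//; last by rewrite poweRyr ?invr_eq0.
    rewrite poweR_EFin lee_fin lte_fin => e0; apply: contraTT; rewrite lee_fin -ltNge -leNgt => e1.
    apply: (@le_trans _ _ (1 `^ 2^-1)); first by rewrite powR1.
    by rewrite ge0_ler_powR ?nnegrE// ltW.
  have := le_trans (fractional_sobolevT s_gt0 sn (mw k) Ioo) E1.
  move: Ioo (integral_power_ge0 s (w k) setT).
  case: (integral_power s (w k) setT) => [i| |]// _; rewrite poweR_EFin -EFinM !lee_fin => i0.
  rewrite -ler_pdivlMl// mulr1 => H.
  rewrite -[leLHS](powRr1 i0) (_ : 1 = (2 / q) * (q / 2)); last first.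
    by field; rewrite gt_eqF.
  rewrite powRrM; apply: ge0_ler_powR; rewrite ?nnegrE ?powR_ge0 ?invr_ge0 ?(ltW c0)//; exact/ltW/divr_gt0.
apply: (@integral_power_lty_sub _ _ _ s_gt0 sn _ (phi N)) => //.
(* What remains is [v - phi N], the a.e. limit of [w k]: Fatou's lemma transfers the uniform bound
   [K] to it. *)
apply: (@le_lt_trans _ _ K%:E); last by rewrite ltry.
apply: (@le_trans _ _ (\int[leb]_x limn_einf (fun k => (`|w k x| `^ q)%:E))%E); last first.
  apply: (le_trans (fatou leb measurableT _ _)).
  - by move=> k; exact: measurable_norm_power.
  - by move=> k x _; rewrite lee_fin powR_ge0.
  by apply: limn_einf_le => k; exact: wK.
apply: ge0_ae_le_integral => [x|x|].
- by rewrite lee_fin powR_ge0.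
- by apply: limn_einf_ge0 => k; rewrite lee_fin powR_ge0.
apply: filterS2 uv phiu => x uvx phix; rewrite -uvx.
apply: power_le_limn_einf => //; apply: cvgB; last exact: cvg_cst.
by rewrite (@cvg_shiftn _ _ (phi ^~ x)).
Qed.

End Ds_integrability.

(** * Cutting along a hyperplane *)

Lemma ge0_integral_bigcup_le d (T : measurableType d) (R : realType)
    (mu : {measure set T -> \bar R}) (F : (set T)^nat) (f : T -> \bar R) (K : \bar R) :
  {homo F : n m / (n <= m)%N >-> (n <= m)%O} -> (forall k, measurable (F k)) ->
  measurable_fun setT f -> (forall x, 0 <= f x)%E ->
  (forall k, \int[mu]_(x in F k) f x <= K)%E ->
  (\int[mu]_(x in \bigcup_k F k) f x <= K)%E.
Proof.
move=> ndF mF mf f0 FK.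
have h := @ge0_nondecreasing_set_cvg_integral _ _ _ F f mu ndF mF
  (fun i => measurable_funTS mf) (fun i x _ => f0 x).
rewrite -(cvg_lim _ h)//; apply: lime_le; first by apply/cvg_ex; eexists; exact: h.
exact: nearW.
Qed.

Section half_space.
Context {R : realType} (m : nat) (s : R).
Local Notation n := m.+1.
Hypotheses (s_gt0 : 0 < s) (sn : 2 * s < n%:R).
Implicit Types (u v : 'rV[R]_n -> R).

Local Notation q := (sobolev_exponent n s).
Local Notation leb := (@rV_lebesgue R n).
Local Notation c := (sobolev_cst n s).

Definition below (t : R) : set 'rV[R]_n := [set x | last_coord x < t].
Definition above (t : R) : set 'rV[R]_n := [set x | t < last_coord x].

Lemma measurable_below t : measurable (below t).
Proof.
rewrite -[X in measurable X]setTI.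
rewrite (_ : below t = (fun x => last_coord x) @^-1` `]-oo, t[%classic).
  by apply: measurable_last_coord => //; exact: measurable_itv.
by apply/seteqP; split => x /=; rewrite in_itv.
Qed.

Lemma measurable_above t : measurable (above t).
Proof.
rewrite -[X in measurable X]setTI.
rewrite (_ : above t = (fun x => last_coord x) @^-1` `]t, +oo[%classic).
  by apply: measurable_last_coord => //; exact: measurable_itv.
by apply/seteqP; split => x /=; rewrite in_itv/= andbT.
Qed.

Lemma box_below t x r : below t x -> 0 < r -> box x r `<=` below t.
Proof.
rewrite /below/= last_coordE => xt r0 y /(_ ord_max)/andP[_ yx] /=.
by rewrite last_coordE (lt_trans yx).
Qed.

Lemma integral_power_below_above v t : measurable_fun setT v ->
  (integral_power s v setT =
   integral_power s v (below t) + integral_power s v (above t))%E.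
Proof.
move=> mv; have mf := measurable_norm_power s mv.
have mN : measurable [set x : 'rV[R]_n | last_coord x = t].
  by rewrite -[X in measurable X]setTI;
    exact: (measurable_last_coord measurableT (measurable_set1 t)).
have f0 (x : 'rV[R]_n) : (0 <= (`|v x| `^ q)%:E)%E by rewrite lee_fin powR_ge0.
rewrite {1}/integral_power (ge0_negligible_integral mN measurableT mf)//; last first.
  exact: rV_lebesgue_hyperplane.
rewrite (_ : setT `\` _ = below t `|` above t); last first.
  apply/seteqP; split => x /=; rewrite /below /above/=.
    by move=> [_ /eqP]; rewrite neq_lt => /orP.
  by move=> H; split => // /eqP; apply/negP; rewrite neq_lt; apply/orP.
rewrite ge0_integral_setU//.
- exact: measurable_below.
- exact: measurable_above.
- exact: measurable_funTS.
apply/disj_setPS => x [] /=; rewrite /below /above /= => xt tx.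
by have := lt_trans xt tx; rewrite ltxx.
Qed.

(* Hyperplanes are null, so the mass below the hyperplane varies continuously. *)
Lemma half_space_split v (j d : R) : measurable_fun setT v ->
  integral_power s v setT = j%:E -> 0 < j -> 0 < d < 1 ->
  exists t, integral_power s v (below t) = (d * j)%:E /\
            integral_power s v (above t) = ((1 - d) * j)%:E.
Proof.
move=> mv vj j0 /andP[d0 d1]; have mf := measurable_norm_power s mv.
have dj : d * j < j by rewrite -[ltRHS]mul1r ltr_pM2r.
have dj' : (1 - d) * j < j by rewrite -[ltRHS]mul1r ltr_pM2r// ltrBlDr ltrDl.
have f0 (x : 'rV[R]_n) : (0 <= (`|v x| `^ q)%:E)%E by rewrite lee_fin powR_ge0.
pose F t := fine (integral_power s v (below t)).
pose G t := fine (integral_power s v (above t)).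
have FGfin t : integral_power s v (below t) = (F t)%:E /\
               integral_power s v (above t) = (G t)%:E.
  have := integral_power_below_above t mv; rewrite vj /F /G.
  have := integral_power_ge0 s v (below t); have := integral_power_ge0 s v (above t).
  by case: (integral_power s v (below t)) => [a| |]//; case: (integral_power s v (above t)).
have FG t : F t + G t = j.
  have := integral_power_below_above t mv; rewrite vj.
  by have [-> ->] := FGfin t => -[].
have ndF t t' : t <= t' -> F t <= F t'.
  move=> tt'; rewrite -lee_fin; have [<- _] := FGfin t; have [<- _] := FGfin t'.
  by apply: ge0_le_integral_nomeas => // x /= xt; split => //; exact: lt_le_trans tt'.
(* The strict inequalities in [below] and [above] make these half-spaces increasing unions of
   smaller ones: bounds on [F] pass to limits from the left, and bounds on [G] to limits from the
   right. *)
have belowU (t : R^nat) (t0 K : R) : (forall i k, (i <= k)%N -> t i <= t k) ->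
    (forall x, x < t0 -> exists k, x < t k) -> (forall k, t k <= t0) ->
    (forall k, F (t k) <= K) -> F t0 <= K.
  move=> ndt tU tt0 FK; rewrite -lee_fin; have [<- _] := FGfin t0.
  rewrite /integral_power (_ : below t0 = \bigcup_k below (t k)).
    apply: ge0_integral_bigcup_le => //.
    - by move=> i k ik; apply/subsetPset => x /= xt; exact: lt_le_trans (ndt _ _ ik).
    - by move=> k; exact: measurable_below.
    by move=> k; have [E _] := FGfin (t k); rewrite -/(integral_power s v (below (t k))) E lee_fin.
  apply/seteqP; split => [x /= /tU[k xk]|x [k _ /= xk]]; first by exists k.
  exact: lt_le_trans (tt0 k).
have aboveU (t : R^nat) (t0 K : R) : (forall i k, (i <= k)%N -> t k <= t i) ->
    (forall x, t0 < x -> exists k, t k < x) -> (forall k, t0 <= t k) ->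
    (forall k, G (t k) <= K) -> G t0 <= K.
  move=> ndt tU tt0 FK; rewrite -lee_fin; have [_ <-] := FGfin t0.
  rewrite /integral_power (_ : above t0 = \bigcup_k above (t k)).
    apply: ge0_integral_bigcup_le => //.
    - by move=> i k ik; apply/subsetPset => x /= xt; exact: le_lt_trans (ndt _ _ ik) xt.
    - by move=> k; exact: measurable_above.
    by move=> k; have [_ E] := FGfin (t k); rewrite -/(integral_power s v (above (t k))) E lee_fin.
  apply/seteqP; split => [x /= /tU[k xk]|x [k _ /= xk]]; first by exists k.
  exact: le_lt_trans (tt0 k) xk.
have natU (x : R) : exists k : nat, x < k%:R.
  by exists (Num.bound `|x|); rewrite (le_lt_trans (ler_norm x))// archi_boundP.
have Fhigh : exists k : nat, d * j < F k%:R.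
  apply: contrapT => H; have : (integral_power s v setT <= (d * j)%:E)%E.
    rewrite /integral_power (_ : setT = \bigcup_(k : nat) below k%:R).
      apply: ge0_integral_bigcup_le => //.
      - move=> i k ik; apply/subsetPset => x /= xt.
        by apply: lt_le_trans xt _; rewrite ler_nat.
      - by move=> k; exact: measurable_below.
      move=> k; have [E _] := FGfin k%:R; rewrite -/(integral_power s v (below k%:R)) E lee_fin.
      by rewrite leNgt; apply/negP => Hk; apply: H; exists k.
    by apply/esym; rewrite -subTset => x _; have [k xk] := natU (last_coord x); exists k.
  by rewrite vj lee_fin leNgt dj.
have Glow : exists k : nat, (1 - d) * j < G (- k%:R).
  apply: contrapT => H; have : (integral_power s v setT <= ((1 - d) * j)%:E)%E.
    rewrite /integral_power (_ : setT = \bigcup_(k : nat) above (- k%:R)).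
      apply: ge0_integral_bigcup_le => //.
      - move=> i k ik; apply/subsetPset => x /= xt.
        by apply: le_lt_trans xt; rewrite lerN2 ler_nat.
      - by move=> k; exact: measurable_above.
      move=> k; have [_ E] := FGfin (- k%:R); rewrite -/(integral_power s v (above (- k%:R))) E lee_fin.
      by rewrite leNgt; apply/negP => Hk; apply: H; exists k.
    apply/esym; rewrite -subTset => x _; have [k xk] := natU (- last_coord x); exists k => //.
    by rewrite /above/= ltrNl.
  by rewrite vj lee_fin leNgt dj'.
(* At [t0 = sup S], approximation from the left gives [F t0 <= d j]. Points beyond [t0] lie outside
   [S], so approximation from the right gives [G t0 <= (1 - d) j]. As [F + G = j], both are
   equalities. *)
pose S := [set t | F t <= d * j].
have S0 : S !=set0.
  have [k Hk] := Glow; exists (- k%:R); rewrite /S /=.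
  move: Hk (FG (- k%:R)); rewrite mulrBl mul1r => Hk Hk'; lra.
have Sub : has_ubound S.
  have [k Hk] := Fhigh; exists k%:R => t /= Ft; rewrite leNgt; apply/negP => /ltW/ndF kt.
  by have := lt_le_trans Hk (le_trans kt Ft); rewrite ltxx.
pose t0 := sup S.
have inv_anti (i k : nat) : (i <= k)%N -> k.+1%:R^-1 <= i.+1%:R^-1 :> R.
  by move=> ik; rewrite lef_pV2 ?posrE ?ltr0n// ler_nat.
have inv_small (e : R) : 0 < e -> exists k : nat, k.+1%:R^-1 < e.
  move=> e0; have [k ke] := natU e^-1; exists k.
  rewrite invf_plt ?posrE//; apply: lt_trans ke _; by rewrite ltr_nat.
have Ft0 : F t0 <= d * j.
  apply: (belowU (fun k => t0 - k.+1%:R^-1)).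
  - by move=> i k ik; rewrite lerD2l lerN2 inv_anti.
  - move=> x xt0; have [|k kx] := inv_small (t0 - x); first by rewrite subr_gt0.
    by exists k; rewrite ltrBrDr -ltrBrDl.
  - by move=> k; rewrite gerDl oppr_le0.
  move=> k; have [|t St tt] := @sup_adherent _ S k.+1%:R^-1 _ (conj S0 Sub).
    by rewrite invr_gt0 ltr0n.
  by apply: le_trans St; apply: ndF; exact: ltW.
have Gt0 : G t0 <= (1 - d) * j.
  apply: (aboveU (fun k => t0 + k.+1%:R^-1)).
  - by move=> i k ik; rewrite lerD2l inv_anti.
  - move=> x xt0; have [|k kx] := inv_small (x - t0); first by rewrite subr_gt0.
    by exists k; rewrite -ltrBrDl.
  - by move=> k; rewrite lerDl.
  move=> k.
  have : ~ S (t0 + k.+1%:R^-1).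
    move=> /(ub_le_sup Sub); rewrite -/t0 gerDl leNgt => /negP; apply.
    by rewrite invr_gt0 ltr0n.
  move=> /negP; rewrite -ltNge; move: (FG (t0 + k.+1%:R^-1)); lra.
exists t0; have [-> ->] := FGfin t0; have := FG t0 => FGt0.
by split; congr EFin; lra.
Qed.

End half_space.

(** * From a cut of the whole space to a Neumann competitor *)

Section neumann_gain.
Context {R : realType} (m : nat) (s : R).
Local Notation n := m.+1.
Hypotheses (s_gt0 : 0 < s) (sn : 2 * s < n%:R).
Implicit Types (u v : 'rV[R]_n -> R).

Local Notation q := (sobolev_exponent n s).
Local Notation leb := (@rV_lebesgue R n).
Local Notation c := (sobolev_cst n s).

Lemma ge0_integral_measure_preserving d (T : measurableType d)
    (mu : {measure set T -> \bar R}) (tau : T -> T) (D : set T) (f : T -> \bar R) :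
  measurable_fun setT tau -> (forall A, measurable A -> mu (tau @^-1` A) = mu A) ->
  measurable D -> measurable_fun setT f -> (forall x, 0 <= f x)%E ->
  (\int[mu]_(x in tau @^-1` D) f (tau x) = \int[mu]_(x in D) f x)%E.
Proof.
move=> mtau tauE mD mf f0.
pose mfm := isMeasurableFun.Build _ _ _ _ _ mtau.
pose F : {mfun T >-> T} := HB.pack tau mfm.
rewrite -[LHS](@ge0_integral_pushforward _ _ _ _ _ tau mtau mu D f)//; last first.
  exact: measurable_funTS.
apply: (@eq_measure_integral _ _ _ _ mu (pushforward mu F)) => A mA _.
exact: tauE.
Qed.

Definition last_basis : 'rV[R]_n := delta_mx ord0 ord_max.

Lemma last_coordD_basis (x : 'rV[R]_n) t :
  last_coord (x + t *: last_basis) = last_coord x + t.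
Proof. by rewrite !last_coordE !mxE !eqxx mulr1. Qed.

Lemma integral_power_translate v t : measurable_fun setT v ->
  integral_power s (fun x => v (x + t *: last_basis)) (@upper_half R n) =
  integral_power s v (above t).
Proof.
move=> mv; rewrite /integral_power.
rewrite -[RHS](@ge0_integral_measure_preserving _ _ _ (fun x : 'rV[R]_n => x + t *: last_basis)).
- congr integral; apply/seteqP; split => x;
    by rewrite /upper_half /above /= last_coordD_basis ltrDr.
- exact: measurable_rV_addr.
- by move=> A mA; exact: rV_lebesgue_translation.
- exact: measurable_above.
- exact: measurable_norm_power.
- by move=> x; rewrite lee_fin powR_ge0.
Qed.

(** The kernel depends on the positions only through [x - y], so shifting both points by [t] along
    the last axis carries [T_upper_half] onto the complement of [below t] squared. Interactions
    across the hyperplane stay in the Neumann energy, hence an exact splitting. *)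
Lemma energy_translate v (t : R) : measurable_fun setT v ->
  (energy s (fun x => v (x + t *: last_basis)%R) (@T_upper_half R n) +
   energy s v (below t `*` below t) = energy s v setT)%E.
Proof.
move=> mv.
have mk := measurable_frac_kernel s mv.
have mB : measurable (below t `*` below t : set ('rV[R]_n * 'rV[R]_n)).
  by apply: measurableX; exact: measurable_below.
have mkE : measurable_fun setT (fun z => (frac_kernel s v z)%:E) by exact/measurable_EFinP.
pose w := t *: last_basis.
pose tau (z : 'rV[R]_n * 'rV[R]_n) := (z.1 + w, z.2 + w).
have mtau : measurable_fun setT tau.
  apply/measurable_fun_pairP; split => /=.
    exact: (measurableT_comp (measurable_rV_addr w)).
  exact: (measurableT_comp (measurable_rV_addr w)).
have -> : energy s (fun x => v (x + w)) (@T_upper_half R n) =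
          energy s v (~` (below t `*` below t)).
  have k0 z : (0 <= (frac_kernel s v z)%:E)%E by exact: (frac_kernel_ge0 s v z).
  have := ge0_integral_measure_preserving mtau (@rV_lebesgue2_translation R n w)
    (measurableC mB) mkE k0.
  rewrite (_ : tau @^-1` _ = @T_upper_half R n); last first.
    apply/seteqP; split => -[x y]; rewrite /T_upper_half /below /lower_half /=;
      by rewrite !last_coordD_basis !gtrDr.
  apply: etrans; rewrite /energy; apply: eq_integral => z _.
  rewrite /frac_kernel /tau /=; congr (EFin (_ / euclid_norm _ `^ _)).
  by rewrite opprD addrACA subrr addr0.
rewrite /energy -ge0_integral_setU//.
- by rewrite setUC setUv.
- exact: measurableC.
- exact: measurable_funTS.
- by move=> z _; exact: (frac_kernel_ge0 s v z).
by apply/disj_setPS => z [].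
Qed.

Lemma integral_power_ae0 v D : {ae leb, forall x, D x -> v x = 0} ->
  integral_power s v D = 0%E.
Proof.
move=> v0; apply/eqP; rewrite eq_le integral_power_ge0 andbT.
rewrite /integral_power integral_mkcond.
apply: (@le_trans _ _ (\int[leb]_x cst 0 x)%E); last by rewrite integral0.
apply: ge0_ae_le_integral => // [x|].
  by rewrite patchE; case: ifP => // _; rewrite lee_fin powR_ge0.
apply: filterS v0 => x vx0; rewrite patchE; case: ifP => // /set_mem/vx0 ->.
by rewrite normr0 powR0// gt_eqF// sobolev_exponent_gt0.
Qed.

Lemma neumann_sobolev_const_ge0 : (0 <= neumann_sobolev_const n s :> \bar R)%E.
Proof.
apply: le_ereal_inf_tmp => _ [v _ <-]; rewrite /sobolev_quotient mule_ge0 ?energy_ge0//.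
by rewrite inve_ge0 poweR_ge0.
Qed.

(** The two pieces of the energy are bounded below by [N ((1 - d) j) ^ (2 / q)], where [N] is the
    Neumann constant, and by [c (d j) ^ (2 / q)]; homogeneity removes [j] on division by
    [j ^ (2 / q)]. *)
Lemma neumann_sobolev_const_gain v (j d : R) : measurable_fun setT v ->
  integral_power s v setT = j%:E -> 0 < j -> 0 < d < 1 ->
  (((1 - d) `^ (2 / q))%:E * neumann_sobolev_const n s + (c * d `^ (2 / q))%:E <=
   sobolev_quotient s v setT setT)%E.
Proof.
move=> mv vj j0 d01; set th := 2 / q.
have /andP[d0 d1] := d01.
have q0 : 0 < q := sobolev_exponent_gt0 s_gt0 sn.
have jth : 0 < j `^ th by rewrite powR_gt0.
rewrite /sobolev_quotient vj poweR_EFin inver gt_eqF//.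
have := energy_ge0 s v setT; case E : (energy s v setT) => [e| |]//; last first.
  by rewrite gt0_mulye ?leey// lte_fin invr_gt0.
rewrite lee_fin => e0.
have [t [Ft Gt]] := half_space_split mv vj j0 d01.
pose w x := v (x + t *: last_basis).
have mw : measurable_fun setT w.
  exact: (measurableT_comp mv (measurable_rV_addr _)).
have wE := energy_translate t mv.
have wI := integral_power_translate t mv; rewrite Gt in wI.
have B : (c%:E * ((d * j)%:E `^ th) <= energy s v (below t `*` below t))%E.
  rewrite -Ft; apply: fractional_sobolev => //.
  - exact: measurable_below.
  - by move=> x r; exact: box_below.
  by rewrite Ft ltry.
move: wE B; rewrite E -/w.
have := energy_ge0 s w (@T_upper_half R n); have := energy_ge0 s v (below t `*` below t).
case Ew : (energy s w _) => [ew| |]//; case: (energy s v (below t `*` below t)) => [eb| |]//.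
rewrite !lee_fin => eb0 ew0 -[ewb].
rewrite -/th powRM ?(ltW d0) ?(ltW j0)// => ceb.
have d1j : 0 < (1 - d) * j by rewrite mulr_gt0// subr_gt0.
have d1th : 0 < (1 - d) `^ th by rewrite powR_gt0// subr_gt0.
have Nw : (neumann_sobolev_const n s <= (ew / ((1 - d) * j) `^ th)%:E)%E.
  apply: ereal_inf_lbound; exists w; last first.
    by rewrite /sobolev_quotient wI Ew poweR_EFin inver gt_eqF ?powR_gt0.
  split; last first.
    move=> /integral_power_ae0; rewrite wI => -[] H.
    by move: d1j; rewrite H ltxx.
  split; [by exists w => //; exact: aeW|by rewrite wI ltry|by rewrite Ew ltry].
apply: (@le_trans _ _ (((1 - d) `^ th)%:E * (ew / ((1 - d) * j) `^ th)%:E + (c * d `^ th)%:E)%E).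
  by rewrite leeD2r// lee_wpmul2l// lee_fin ltW.
rewrite -!EFinM -EFinD lee_fin powRM ?subr_ge0 ?(ltW d1) ?(ltW j0)//.
have -> : (1 - d) `^ th * (ew / ((1 - d) `^ th * j `^ th)) + c * d `^ th =
  (ew + c * (d `^ th * j `^ th)) / j `^ th by field; rewrite !gt_eqF.
by rewrite ler_pM2r ?invr_gt0// -ewb lerD2l.
Qed.

End neumann_gain.

(** * A test function of finite energy *)

Section tent_energy.
Context {R : realType} (m : nat) (s : R).
Local Notation n := m.+1.
Hypotheses (s01 : 0 < s < 1) (sn : 2 * s < n%:R).

Local Notation q := (sobolev_exponent n s).
Local Notation leb := (@rV_lebesgue R n).

(** Competitors for the half-space need no smoothness; a bounded Lipschitz function of compact
    support has finite energy because [0 < s < 1]. *)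
Definition tent (x : 'rV[R]_n) : R := Num.max 0 (1 - `|x|).

Lemma tent_ge0 x : 0 <= tent x.
Proof. by rewrite /tent le_max lexx. Qed.

Lemma tent_le1 x : tent x <= 1.
Proof. by rewrite /tent ge_max ler01 gerBl normr_ge0. Qed.

Lemma tent_lipschitz x y : `|tent x - tent y| <= `|x - y|.
Proof.
wlog xy : x y / tent y <= tent x.
  move=> H; have [/H//|/ltW/H] := leP (tent y) (tent x).
  by rewrite distrC [X in _ <= X]distrC.
rewrite ger0_norm ?subr_ge0// lerBlDr {1}/tent ge_max addr_ge0 ?tent_ge0//=.
have ty : 1 - `|y| <= tent y by rewrite /tent le_max lexx orbT.
have := lerB_dist y x; rewrite distrC; move: ty; lra.
Qed.

Lemma continuous_tent : continuous tent.
Proof.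
move=> x; apply/(@cvgrPdist_le R R 'rV[R]_n (nbhs x) (nbhs_filter x)) => e e0.
have : \forall y \near x, `|x - y| <= e.
  by move: e e0; apply/(@cvgrPdist_le R 'rV[R]_n 'rV[R]_n (nbhs x) (nbhs_filter x) id x).
by apply: filterS => y; apply: le_trans; exact: tent_lipschitz.
Qed.

Lemma measurable_tent : measurable_fun setT tent.
Proof. apply: continuous_measurable_rV; exact: continuous_tent. Qed.

Definition cube : set 'rV[R]_n := box (const_mx 2) 4.

Lemma tent_cube x : tent x != 0 -> cube x.
Proof.
rewrite /tent; have [x1|x1 _ i] := leP (1 - `|x|) 0; first by rewrite eqxx.
 rewrite !mxE (_ : 2 - 4 = - 2 :> R); last by ring.
rewrite -ltr_norml (@le_lt_trans _ _ `|x|)//; last first.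
  by rewrite subr_gt0 in x1; rewrite (lt_trans x1)// ltr1n.
rewrite [leRHS]/Num.norm/= mx_normrE.
exact: (le_bigmax _ (fun ij : 'I_1 * 'I_n => `|x ij.1 ij.2|) (ord0, i)).
Qed.

(** The sup norm makes the sections of [sep z < r] cubes of known measure; being at most the
    Euclidean norm, it still bounds the kernel from above. *)
Definition sep (z : 'rV[R]_n * 'rV[R]_n) : R := `|z.1 - z.2|.

Lemma measurable_sep : measurable_fun setT sep.
Proof.
have mn : measurable_fun setT (fun x : 'rV[R]_n => `|x|).
  by apply: continuous_measurable_rV => x; exact: norm_continuous.
apply: (measurableT_comp mn); apply/measurable_fun_rVP => i.
rewrite (_ : _ \o _ = (fun z => rV_coord i z.1 - rV_coord i z.2)).
  apply: measurable_funB.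
    by apply: measurableT_comp => //; exact: measurable_rV_coord.
  by apply: measurableT_comp => //; exact: measurable_rV_coord.
by apply/funext => z; rewrite /rV_coord /= !mxE.
Qed.

Lemma measurable_sep_lt r : measurable [set z | sep z < r].
Proof.
rewrite -[X in measurable X]setTI.
rewrite (_ : [set z | _] = sep @^-1` `]-oo, r[%classic).
  by apply: measurable_sep => //; exact: measurable_itv.
by apply/seteqP; split => x /=; rewrite in_itv.
Qed.

Lemma measurable_sep_ge r : measurable [set z | r <= sep z].
Proof.
rewrite -[X in measurable X]setTI.
rewrite (_ : [set z | _] = sep @^-1` `[r, +oo[%classic).
  by apply: measurable_sep => //; exact: measurable_itv.
by apply/seteqP; split => x /=; rewrite in_itv/= andbT.
Qed.

(** The product measure is computed from sections at a fixed first point; the swap reduces the half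
    of [near_cube] that confines the second point to the half that confines the first. *)
Lemma leb2_swap (A : set ('rV[R]_n * 'rV[R]_n)) : measurable A ->
  ((leb \x leb) (unstable.swap @^-1` A) = (leb \x leb) A)%E.
Proof.
move=> mA.
pose F : {mfun _ >-> _} := HB.pack (@unstable.swap 'rV[R]_n 'rV[R]_n)
  (isMeasurableFun.Build _ _ _ _ _ (@measurable_swap _ _ 'rV[R]_n 'rV[R]_n)).
symmetry; apply: (@product_measure_unique _ _ _ _ _ _ _ (pushforward (leb \x leb)%E F)) => //.
move=> B C mB mC; rewrite /pushforward /=.
transitivity ((leb \x leb)%E (C `*` B)).
  by congr ((leb \x leb)%E _); apply/seteqP; split => -[x y] [].
by rewrite [LHS]product_measure1E// muleC.
Qed.

(** [tent] vanishes off [cube], so its kernel vanishes off this set. *)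
Definition near_cube : set ('rV[R]_n * 'rV[R]_n) := (cube `*` setT) `|` (setT `*` cube).

Let mcube : measurable cube. Proof. exact: measurable_box. Qed.

Lemma measurable_near_cube : measurable near_cube.
Proof. by apply: measurableU; exact: measurableX. Qed.

Lemma leb2_cube_sep_lt r : 0 < r ->
  ((leb \x leb) ((cube `*` setT) `&` [set z | (sep z < r)%R]) <=
   (4 ^+ n * (2 * r) ^+ n)%:E)%E.
Proof.
move=> r0; set A := _ `&` _.
have r20 : 0 <= 2 * r by rewrite mulr_ge0// ltW.
apply: (@le_trans _ _ (\int[leb]_(x in cube) ((2 * r) ^+ n)%:E)%E); last first.
  rewrite integral_cst// [X in (_ * X)%E](rV_lebesgue_box _ (_ : 0 <= 4 :> R))//.
  by rewrite -EFinM mulrC.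
rewrite /product_measure1 /= [leRHS]integral_mkcond.
apply: ge0_le_integral_nomeas => x.
- exact: measure_ge0.
- by rewrite patchE; case: ifP => // _; rewrite lee_fin exprn_ge0.
move=> _; split => //; rewrite patchE; case: ifPn => [_|/negP xQ].
  rewrite -(rV_lebesgue_box (x + const_mx r) r20).
  apply: le_measure; rewrite ?inE.
  - apply: measurable_xsection; apply: measurableI; last exact: measurable_sep_lt.
    exact: measurableX.
  - exact: measurable_box.
  move=> y; rewrite /xsection/= inE => -[_ /=].
  rewrite /sep [ltLHS]/Num.norm/= mx_normrE => xy i.
  have : `|(x - y) ord0 i| < r.
    apply: le_lt_trans xy.
    exact: (le_bigmax _ (fun ij : 'I_1 * 'I_n => `|(x - y) ij.1 ij.2|) (ord0, i)).
  by rewrite !mxE ltr_norml => /andP[h1 h2]; apply/andP; split; lra.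
rewrite (_ : xsection A x = set0) ?measure0// -subset0 => y.
by rewrite /xsection/= inE => -[[/= xQ' _] _]; apply: xQ; rewrite inE.
Qed.

Lemma leb2_near_cube_sep_lt r : 0 < r ->
  ((leb \x leb) (near_cube `&` [set z | (sep z < r)%R]) <=
   (2 * (4 ^+ n * (2 * r) ^+ n))%:E)%E.
Proof.
move=> r0; rewrite /near_cube setIUl.
have mA : measurable ((cube `*` setT) `&` [set z | sep z < r]).
  by apply: measurableI; [exact: measurableX|exact: measurable_sep_lt].
have mB : measurable ((setT `*` cube) `&` [set z | sep z < r]).
  by apply: measurableI; [exact: measurableX|exact: measurable_sep_lt].
apply: (le_trans (measureU2 _ mA mB)).
rewrite mulr_natl mulr2n EFinD; apply: leeD; first exact: leb2_cube_sep_lt.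
apply: le_trans (leb2_cube_sep_lt r0).
have mA' : measurable (unstable.swap @^-1` ((cube `*` setT) `&` [set z | sep z < r])).
  by rewrite -[X in measurable X]setTI; exact: measurable_swap.
apply: (@le_trans _ _ ((leb \x leb)%E (unstable.swap @^-1` ((cube `*` setT) `&` [set z | sep z < r])))).
  apply: le_measure; rewrite ?inE//.
  by move=> [x y] [[_ /= yQ]]; rewrite /sep /= distrC => xy; split.
rewrite le_eqVlt; apply/orP; left; apply/eqP; exact: leb2_swap mA.
Qed.

Let p_gt0 : 0 < n%:R + 2 * s.
Proof. by have /andP[s0 _] := s01; rewrite addr_gt0// ?ltr0n// mulr_gt0. Qed.

Definition shell (r : R) := near_cube `&` [set z | sep z < 2 * r] `&` [set z | r <= sep z].

Lemma measurable_shell r : measurable (shell r).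
Proof.
apply: measurableI; last exact: measurable_sep_ge.
by apply: measurableI; [exact: measurable_near_cube|exact: measurable_sep_lt].
Qed.

(** On the shell the kernel is at most [L ^ 2 / r ^ (n + 2s)], and the shell has measure at most
    [2 * 4 ^ n * (4r) ^ n]; the powers [r ^ n] cancel. *)
Lemma integral_shell (r L : R) : 0 < r ->
  (forall z, shell r z -> `|tent z.1 - tent z.2| <= L) ->
  (\int[leb \x leb]_(z in shell r) (frac_kernel s tent z)%:E <=
   (L ^+ 2 * (2 * 4 ^+ n * 4 ^+ n) * r `^ (- (2 * s)))%:E)%E.
Proof.
move=> r0 HL; pose k0 := L ^+ 2 / r `^ (n%:R + 2 * s).
have k00 : 0 <= k0 by rewrite divr_ge0 ?sqr_ge0 ?powR_ge0.
apply: (@le_trans _ _ (\int[leb \x leb]_(z in shell r) k0%:E)%E).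
  apply: ge0_le_integral_nomeas => z; rewrite ?lee_fin ?frac_kernel_ge0// => zr.
  split => //; rewrite /frac_kernel; have [_ /= rz] := zr.
  apply: ler_pM; rewrite ?sqr_ge0 ?invr_ge0 ?powR_ge0//.
    rewrite -(real_normK (num_real (_ - _))) lerXn2r ?nnegrE//.
      by rewrite (le_trans _ (HL z zr)).
    exact: HL.
  have re : r <= euclid_norm (z.1 - z.2) by rewrite (le_trans rz)// normr_le_euclid_norm.
  rewrite lef_pV2 ?posrE ?powR_gt0//; last exact: lt_le_trans re.
  by rewrite ge0_ler_powR ?nnegrE ?euclid_norm_ge0 ?(ltW r0) ?(ltW p_gt0).
rewrite integral_cst; last exact: measurable_shell.
have r20 : 0 < 2 * r by rewrite mulr_gt0.
have H : ((leb \x leb) (shell r) <= (2 * (4 ^+ n * (2 * (2 * r)) ^+ n))%:E)%E.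
  apply: le_trans (leb2_near_cube_sep_lt r20).
  apply: le_measure; rewrite ?inE; [exact: measurable_shell| |by move=> z []].
  by apply: measurableI; [exact: measurable_near_cube|exact: measurable_sep_lt].
apply: (le_trans (lee_wpmul2l _ H)); first by rewrite lee_fin.
rewrite -EFinM lee_fin le_eqVlt; apply/orP; left; apply/eqP.
rewrite (mulrA 2 2 r) (_ : 2 * 2 = 4 :> R); last by ring.
rewrite exprMn powRN /k0 powRD ?(gt_eqF r0) ?implybT// powR_mulrn ?(ltW r0)//.
by field; rewrite !gt_eqF ?powR_gt0 ?exprn_gt0.
Qed.

(** [a] and [b] are the ratios of two geometric series. On far shells the values of [tent] differ by
    at most 1, the energy decays like [r ^ (-2s)], and [a < 1] as [s > 0]. On near shells the
    Lipschitz bound [2r] gives [r ^ (2 - 2s)], and [b < 1] as [s < 1]. *)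
Let h : R := 2^-1.
Let a := h `^ (2 * s).
Let b := h `^ (2 - 2 * s).
Let C : R := 2 * 4 ^+ n * 4 ^+ n.

Let h0 : 0 < h. Proof. by rewrite invr_gt0. Qed.

Let hpow_lt1 t : 0 < t -> h `^ t < 1.
Proof.
move=> t0; apply: (@lt_le_trans _ _ (1 `^ t)); last by rewrite powR1.
by apply: gt0_ltr_powR => //; rewrite ?nnegrE ?invr_ge0//; rewrite /h; lra.
Qed.

Let a1 : a < 1.
Proof. by apply: hpow_lt1; have /andP[s0 _] := s01; rewrite mulr_gt0. Qed.

Let b1 : b < 1.
Proof. by apply: hpow_lt1; have /andP[_ s1] := s01; lra. Qed.

Lemma integral_shell_far k :
  (\int[leb \x leb]_(z in shell (2 ^+ k)) (frac_kernel s tent z)%:E <= (C * a ^+ k)%:E)%E.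
Proof.
have H : 0 < 2 ^+ k :> R by rewrite exprn_gt0.
apply: (le_trans (integral_shell (L := 1) H _)).
  move=> z _; have := tent_ge0 z.1; have := tent_ge0 z.2.
  have := tent_le1 z.1; have := tent_le1 z.2 => h1 h2 h3 h4.
  by rewrite ler_norml; apply/andP; split; lra.
rewrite lee_fin expr1n mul1r /C ler_pM2l ?mulr_gt0 ?exprn_gt0//.
have -> : (2 ^+ k) `^ (- (2 * s)) = (h ^+ k) `^ (2 * s).
  by rewrite /h exprVn -(powR_inv1 (ltW H)) -powRrM mulN1r.
by rewrite -(powR_mulrn _ (ltW h0)) powRAC powR_mulrn ?powR_ge0.
Qed.

Lemma integral_shell_near k :
  (\int[leb \x leb]_(z in shell (h ^+ k.+1)) (frac_kernel s tent z)%:E <=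
   (4 * C * b * b ^+ k)%:E)%E.
Proof.
have H : 0 < h ^+ k.+1 by rewrite exprn_gt0.
apply: (le_trans (integral_shell (L := 2 * h ^+ k.+1) H _)).
  by move=> z [[_ /= zr] _]; rewrite (le_trans (tent_lipschitz _ _))// ltW.
rewrite lee_fin -(mulrA _ b) -exprS exprMn -/C.
have -> : b ^+ k.+1 = (h ^+ k.+1) ^+ 2 * (h ^+ k.+1) `^ (- (2 * s)).
  rewrite -(powR_mulrn 2 (ltW H)) -powRD ?(gt_eqF H) ?implybT//.
  by rewrite -(powR_mulrn _ (powR_ge0 _ _)) /b powRAC powR_mulrn// ltW.
by rewrite le_eqVlt; apply/orP; left; apply/eqP; ring.
Qed.

(** Passing to [N.+1] adds [shell (2 ^+ N)] outside and [shell (h ^+ N.+1)] inside. As [annulus 0]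
    is empty, both geometric sums in the bound have exactly [N] terms. *)
Definition annulus (N : nat) := near_cube `&` [set z | h ^+ N <= sep z] `&` [set z | sep z < 2 ^+ N].

Lemma measurable_annulus N : measurable (annulus N).
Proof.
apply: measurableI; last exact: measurable_sep_lt.
by apply: measurableI; [exact: measurable_near_cube|exact: measurable_sep_ge].
Qed.

Let mK : measurable_fun setT (fun z => (frac_kernel s tent z)%:E).
Proof. by apply/measurable_EFinP; apply: measurable_frac_kernel; exact: measurable_tent. Qed.

Let K0 z : (0 <= (frac_kernel s tent z)%:E)%E.
Proof. by rewrite lee_fin frac_kernel_ge0. Qed.

Lemma ge0_integral_setU_le d (T : measurableType d) (mu : {measure set T -> \bar R})
    (A B : set T) (f : T -> \bar R) : measurable A -> measurable B ->
  measurable_fun setT f -> (forall x, 0 <= f x)%E ->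
  (\int[mu]_(x in A `|` B) f x <= \int[mu]_(x in A) f x + \int[mu]_(x in B) f x)%E.
Proof.
move=> mA mB mf f0; rewrite (_ : A `|` B = A `|` (B `\` A)); last first.
  apply/seteqP; split => x /=; last by move=> [|[]]; [left|right].
  by have [Ax|nAx] := pselect (A x); [left|move=> [|Bx]; [left|right]].
rewrite ge0_integral_setU//.
- by rewrite leeD2l//; apply: ge0_le_integral_nomeas => // x [].
- exact: measurableD.
- exact: measurable_funTS.
- by apply/disj_setPS => x [Ax []].
Qed.

Lemma integral_annulus N :
  (\int[leb \x leb]_(z in annulus N) (frac_kernel s tent z)%:E <=
   (C * ((1 - a ^+ N) / (1 - a)) + 4 * C * b * ((1 - b ^+ N) / (1 - b)))%:E)%E.
Proof.
elim: N => [|N IHN].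
  rewrite (_ : annulus 0 = set0) ?integral_set0.
    by rewrite !expr0 !subrr !mul0r !mulr0 addr0.
  by rewrite -subset0 => z [[_ /=]]; rewrite !expr0 => z1 z2; have := le_lt_trans z1 z2; rewrite ltxx.
have -> : (C * ((1 - a ^+ N.+1) / (1 - a)) + 4 * C * b * ((1 - b ^+ N.+1) / (1 - b)))%:E =
  ((C * ((1 - a ^+ N) / (1 - a)) + 4 * C * b * ((1 - b ^+ N) / (1 - b)))%:E +
  ((C * a ^+ N)%:E + (4 * C * b * b ^+ N)%:E))%E.
  rewrite -!EFinD; congr EFin; rewrite !exprS; field.
  by rewrite !gt_eqF ?subr_gt0.
apply: (@le_trans _ _ (\int[leb \x leb]_(z in annulus N `|` (shell (2 ^+ N) `|` shell (h ^+ N.+1))) (frac_kernel s tent z)%:E)%E).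
  apply: ge0_le_integral_nomeas => // z [[zQ /= z1] z2]; split => //.
  have [zh|zh] := leP (h ^+ N) (sep z).
    have [z2'|z2'] := leP (2 ^+ N) (sep z); last by left.
    by right; left; split => //; split => //=; rewrite -exprS.
  right; right; split => //; split => //=.
  by rewrite exprS mulrA /h divff// mul1r.
have mS r : measurable (shell r) by exact: measurable_shell.
apply: (le_trans (ge0_integral_setU_le _ (measurable_annulus N) _ mK K0)).
  by apply: measurableU.
apply: leeD => //; apply: (le_trans (ge0_integral_setU_le _ _ _ mK K0)) => //.
by apply: leeD; [exact: integral_shell_far|exact: integral_shell_near].
Qed.

Lemma energy_tent_lty : (energy s tent setT < +oo)%E.
Proof.
have a0 : 0 <= a by rewrite powR_ge0.
have b0 : 0 <= b by rewrite powR_ge0.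
have C0 : 0 <= C by rewrite !mulr_ge0 ?exprn_ge0.
apply: (@le_lt_trans _ _ (C / (1 - a) + 4 * C * b / (1 - b))%:E); last by rewrite ltry.
apply: (@le_trans _ _ (\int[leb \x leb]_(z in \bigcup_N annulus N) (frac_kernel s tent z)%:E)%E).
  rewrite /energy [leRHS]integral_mkcond.
  apply: ge0_le_integral_nomeas => z; first exact: K0.
    by rewrite patchE; case: ifP.
  move=> _; split => //; rewrite patchE; case: ifPn => // /negP zA.
  suff -> : tent z.1 - tent z.2 = 0 by rewrite expr0n/= mul0r.
  apply: contrapT => /eqP tz; apply: zA; rewrite inE.
  have zz : 0 < sep z.
    rewrite normr_gt0; apply: contra tz; rewrite subr_eq0 => /eqP ->.
    by rewrite subrr.
  (* One integer dominates the distance and its inverse; with [k <= 2 ^ k] this yields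
     [h ^ k <= sep z < 2 ^ k]. *)
  have [k Hk] : exists k : nat, (sep z)^-1 + sep z < k%:R.
    exists (Num.bound ((sep z)^-1 + sep z)); rewrite (le_lt_trans (ler_norm _))//.
    by rewrite -{2}(@gtr0_norm _ ((sep z)^-1 + sep z)) ?archi_boundP// addr_gt0// invr_gt0.
  have k2 : k%:R <= 2 ^+ k :> R by rewrite -natrX ler_nat ltnW// ltn_expl.
  exists k => //; split; last first.
    by rewrite /= (lt_le_trans _ k2)// (lt_trans _ Hk)// ltrDr invr_gt0.
  split; last first.
    rewrite /= /h exprVn invf_ple ?posrE ?exprn_gt0//.
    by rewrite (le_trans _ k2)// ltW// (lt_trans _ Hk)// ltrDl.
  have [t1|t1] := eqVneq (tent z.1) 0; last by left; split => //; exact: tent_cube.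
  right; split => //; apply: tent_cube; apply: contra tz => /eqP ->.
  by rewrite t1 subrr.
apply: ge0_integral_bigcup_le => //.
- move=> i k ik; apply/subsetPset => z [[zQ /= z1] z2]; split; first split => //=.
    apply: le_trans z1; rewrite ler_wiXn2l // ?(ltW h0)// /h; lra.
  by apply: lt_le_trans z2 _; rewrite ler_eXn2l ?ltr1n.
- exact: measurable_annulus.
move=> N; apply: (le_trans (integral_annulus N)); rewrite lee_fin.
apply: lerD.
  rewrite ler_wpM2l// ler_piMl ?invr_ge0 ?subr_ge0 ?(ltW a1)// gerBl exprn_ge0//.
rewrite ler_wpM2l ?mulr_ge0// ler_piMl ?invr_ge0 ?subr_ge0 ?(ltW b1)//.
by rewrite gerBl exprn_ge0.
Qed.

End tent_energy.

(** * Strict inequality *)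

Section conclusion.
Context {R : realType} (m : nat) (s : R).
Local Notation n := m.+1.
Hypotheses (s01 : 0 < s < 1) (sn : 2 * s < n%:R).

Local Notation q := (sobolev_exponent n s).
Local Notation leb := (@rV_lebesgue R n).
Local Notation c := (sobolev_cst n s).

Let s_gt0 : 0 < s. Proof. by have /andP[] := s01. Qed.

Lemma integral_power_eq0 (v : 'rV[R]_n -> R) D : measurable_fun setT v -> measurable D ->
  integral_power s v D = 0%E -> {ae leb, forall x, D x -> v x = 0}.
Proof.
move=> mv mD v0.
have mf : measurable_fun D (fun x => (`|v x| `^ q)%:E).
  by apply: measurable_funTS; exact: measurable_norm_power.
have /(ae_eq_integral_abs leb mD mf) : (\int[leb]_(x in D) `|(`|v x| `^ q)%:E| = 0)%E.
  rewrite -v0; apply: eq_integral => x _.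
  by rewrite gee0_abs// lee_fin powR_ge0.
apply: filterS => x H /H /= [] /powR_eq0_eq0/eqP.
by rewrite normr_eq0 => /eqP.
Qed.

Lemma integral_power_tent_lty D : (integral_power s (@tent R m) D < +oo)%E.
Proof.
apply: (@le_lt_trans _ _ (\int[leb]_(x in @cube R m) 1%:E)%E); last first.
  rewrite integral_cst; last exact: measurable_box.
  by rewrite [X in (_ * X)%E](rV_lebesgue_box _ (_ : 0 <= 4 :> R))// -EFinM ltry.
have q0 : 0 < q := sobolev_exponent_gt0 s_gt0 sn.
rewrite /integral_power [leLHS]integral_mkcond [leRHS]integral_mkcond.
apply: ge0_le_integral_nomeas => x.
- by rewrite patchE; case: ifP => // _; rewrite lee_fin powR_ge0.
- by rewrite patchE; case: ifP.
move=> _; split => //; rewrite !patchE; case: ifP => _; last by case: ifP.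
have [t0|/tent_cube xQ] := eqVneq (tent x) 0.
  by rewrite t0 normr0 powR0 ?gt_eqF//; case: ifP.
rewrite mem_set// lee_fin ger0_norm ?tent_ge0//.
apply: (@le_trans _ _ (1 `^ q)); last by rewrite powR1.
by apply: ge0_ler_powR; rewrite ?nnegrE ?tent_ge0 ?tent_le1 ?(ltW q0).
Qed.

Lemma neumann_sobolev_const_lty : (neumann_sobolev_const n s < +oo :> \bar R)%E.
Proof.
have tp := @integral_power_tent_lty (@upper_half R n).
have Elty : (energy s (@tent R m) (@T_upper_half R n) < +oo)%E.
  apply: (le_lt_trans _ (@energy_tent_lty R m s s01)).
  by apply: ge0_le_integral_nomeas => // z; exact: (frac_kernel_ge0 s (@tent R m) z).
have ntent : ~ {ae leb, forall x, upper_half x -> @tent R m x = 0}.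
  move=> [N [mN N0 subN]].
  (* This box is []0, 1/2[ ^ n], a set of positive measure in the upper half-space on which [tent]
     is positive. *)
  have : (leb (box (const_mx 2^-1%R) 2^-1%R) <= leb N)%E.
    apply: le_measure; rewrite ?inE//; first exact: measurable_box.
    move=> x xB; apply: subN => /= H.
    have x0 i : 0 < x ord0 i < 2^-1 by have := xB i; rewrite mxE subrr.
    have := H; rewrite /upper_half/= last_coordE; have /andP[-> _] := x0 ord_max.
    move=> /(_ isT); rewrite /tent; apply/eqP; rewrite gt_eqF// lt_max subr_gt0.
    apply/orP; right; apply: (@le_lt_trans _ _ 2^-1); last by rewrite invf_lt1// ltr1n.
    rewrite [leLHS]/Num.norm/= mx_normrE; apply/bigmax_leP; split; first by rewrite invr_ge0.
    move=> [i j] _ /=; rewrite (ord1 i); have /andP[xj0 xj1] := x0 j.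
    by rewrite gtr0_norm// ltW.
  rewrite N0 rV_lebesgue_box ?invr_ge0// lee_fin leNgt => /negP; apply.
  by rewrite exprn_gt0// invr_gt0.
apply: (@le_lt_trans _ _ (sobolev_quotient s (@tent R m) (@T_upper_half R n) (@upper_half R n))).
  apply: ereal_inf_lbound; exists (@tent R m) => //; split => //; split => //.
  by exists (@tent R m); [exact: measurable_tent|exact: aeW].
rewrite /sobolev_quotient.
have ip0 : integral_power s (@tent R m) (@upper_half R n) != 0%E.
  apply/eqP => ip0; apply: ntent.
  apply: integral_power_eq0 ip0; [exact: measurable_tent|].
  exact: (measurable_above (0 : R)).
move: tp ip0 (integral_power_ge0 s (@tent R m) (@upper_half R n)).
case: (integral_power _ _ _) => [i| |]// _ i0; rewrite lee_fin => i_ge0.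
move: Elty (energy_ge0 s (@tent R m) (@T_upper_half R n)).
case: (energy _ _ _) => [e| |]// _ _.
have i_gt0 : 0 < i by rewrite lt_def -eqe i0.
rewrite poweR_EFin inver gt_eqF ?powR_gt0//.
by rewrite -EFinM ltry.
Qed.

(** The cut applies to Borel functions of finite positive mass: [u] is replaced by a Borel
    representative [v] with the same quotient, whose mass is finite by membership in [Ds] and
    nonzero because [u] does not vanish a.e. *)
Lemma Ds_quotient_gain u (d : R) : Ds s u -> ~ {ae leb, forall x, u x = 0} -> 0 < d < 1 ->
  (((1 - d) `^ (2 / q))%:E * neumann_sobolev_const n s + (c * d `^ (2 / q))%:E <=
   sobolev_quotient s u setT setT)%E.
Proof.
move=> Du u0 d01; have [[v mv uv] _] := Du.
have -> : sobolev_quotient s u setT setT = sobolev_quotient s v setT setT.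
  rewrite /sobolev_quotient; congr (_ * (_ `^ _)^-1)%E.
    apply: ge0_ae_eq_integral_nomeas => [z|z|]; [exact: (frac_kernel_ge0 s u z)|exact: (frac_kernel_ge0 s v z)|].
    have [N [mN N0 subN]] := uv.
    (* The two kernels can differ only if one of the points lies in the null set [N]; both strips
       are null by the convention that 0 times infinity is 0. *)
    exists (N `*` setT `|` setT `*` N); split.
    - by apply: measurableU; exact: measurableX.
    - have N1 : (leb \x leb)%E (N `*` setT) = 0%E.
        rewrite [LHS]product_measure1E// -[RHS](mul0e (leb setT)).
        by congr (_ * _)%E; exact: N0.
      have N2 : (leb \x leb)%E (setT `*` N) = 0%E.
        rewrite [LHS]product_measure1E// -[RHS](mule0 (leb setT)).
        by congr (_ * _)%E; exact: N0.
      have mN1 : measurable (N `*` (setT : set 'rV[R]_n)) by exact: measurableX.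
      have mN2 : measurable ((setT : set 'rV[R]_n) `*` N) by exact: measurableX.
      apply/eqP; rewrite -measure_le0 (le_trans (measureU2 _ mN1 mN2))//.
      by rewrite [X in (X + _)%E]N1 [X in (_ + X)%E]N2 adde0.
    move=> [x y] /= H; have [ux|ux] := pselect (u x = v x).
      right; split => //=; apply: subN => /= uy; apply: H; by rewrite ux uy.
    by left; split => //=; exact: subN.
  apply: ge0_ae_eq_integral_nomeas => [x|x|]; rewrite ?lee_fin ?powR_ge0//.
  by apply: filterS uv => x ->.
have vlty := Ds_integral_power_lty s_gt0 sn Du mv uv.
have v0 : integral_power s v setT != 0%E.
  apply/eqP => v0; apply: u0.
  have := integral_power_eq0 mv measurableT v0.
  by apply: filterS2 uv => x -> ->.
move: (integral_power_ge0 s v setT) vlty v0.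
case E : (integral_power s v setT) => [j| |]// j0 _ jn0.
have j_gt0 : 0 < j by rewrite lt_def -eqe jn0.
exact: neumann_sobolev_const_gain s_gt0 sn _ _ _ mv E j_gt0 d01.
Qed.

Lemma neumann_lt_sobolev : (neumann_sobolev_const n s < sobolev_const n s :> \bar R)%E.
Proof.
have th_b : 2 / q = 1 - 2 * s / n%:R := two_div_sobolev_exponent s_gt0 sn.
have c0 := sobolev_cst_gt0 s_gt0 sn.
have gain d : 0 < d < 1 ->
    (((1 - d) `^ (2 / q))%:E * neumann_sobolev_const n s + (c * d `^ (2 / q))%:E <=
     sobolev_const n s)%E.
  by move=> d01; apply: le_ereal_inf_tmp => _ [u [Du u0] <-]; exact: Ds_quotient_gain.
have := neumann_sobolev_const_lty; have := neumann_sobolev_const_ge0 m s.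
case EN : (neumann_sobolev_const n s) => [N| |]// N0 _.
have : (0 <= sobolev_const n s :> \bar R)%E.
  apply: le_ereal_inf_tmp => _ [v _ <-].
  by rewrite /sobolev_quotient mule_ge0 ?energy_ge0// inve_ge0 poweR_ge0.
case ES : (sobolev_const n s) => [S| |]//; last by rewrite ltry.
rewrite lee_fin => S0.
rewrite lte_fin ltNge; apply/negP => SN.
rewrite lee_fin in N0.
have b0 : 0 < 2 * s / n%:R by rewrite divr_gt0 ?mulr_gt0 ?ltr0n.
have b1 : 2 * s / n%:R < 1 by rewrite ltr_pdivrMr ?ltr0n// mul1r.
set b := 2 * s / n%:R in th_b b0 b1.
have Sc : 0 < S + c + 1 by lra.
(* Under [S <= N] the gain forces [c d ^ (2 / q) <= S d]. Since [2 / q = 1 - b], a contradiction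
   requires [S d ^ b < c]; the choice [d ^ b = c / (S + c + 1)] achieves this and also keeps [d]
   below 1, even for [S = 0]. *)
pose d := (c / (S + c + 1)) `^ b^-1.
have cS0 : 0 < c / (S + c + 1) by rewrite divr_gt0.
have d0 : 0 < d by rewrite powR_gt0.
have d1 : d < 1.
  apply: (@lt_le_trans _ _ (1 `^ b^-1)); last by rewrite powR1.
  apply: gt0_ltr_powR; rewrite ?invr_gt0 ?nnegrE ?(ltW cS0)//.
  by rewrite ltr_pdivrMr// mul1r; lra.
have db : d `^ b = c / (S + c + 1).
  by rewrite /d -powRrM mulVf ?gt_eqF// powRr1// ltW.
have dth : d `^ (2 / q) * d `^ b = d.
  by rewrite th_b -powRD ?(gt_eqF d0) ?implybT// subrK powRr1// ltW.
have := gain d; rewrite d0 d1 EN ES -EFinM -EFinD lee_fin => /(_ isT).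
have : 1 - d <= (1 - d) `^ (2 / q).
  rewrite -{1}(@powRr1 _ (1 - d)) ?subr_ge0 ?(ltW d1)//.
  apply: ger_powR; first by rewrite subr_gt0 d1 gerBl ltW.
  by rewrite th_b gerBl ltW.
have dth0 : 0 < d `^ (2 / q) by rewrite powR_gt0.
move: dth dth0; set D := d `^ (2 / q); set P := (1 - d) `^ _ => dth D0 dP H.
have H1 : (1 - d) * S <= P * N by apply: ler_pM; rewrite ?subr_ge0 ?(ltW d1).
have H2 : S * d < c * D.
  rewrite -dth db mulrCA mulrC ltr_pM2r// mulrA ltr_pdivrMr//; nra.
by move: H H1 H2; lra.
Qed.

End conclusion.

Theorem theorem1p3 (R : realType) (s : R) (n : nat)
  (hs : 0 < s < 1) (hn : (1 <= n)%N) (hns : 2 * s < n%:R) :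
  (neumann_sobolev_const n s < sobolev_const n s)%E.
Proof. by case: n hn hns => // m _ hns; exact: neumann_lt_sobolev. Qed.
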